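(* Let $n\ge3$, $\alpha\in(0,n)$, $p,q>0$ with $pq>1$, and let $u,v$ be bounded positive solutions on $\mathbb{R}^n$ of $$u(x)=\int_{\mathbb{R}^n}\frac{v^q(y)\,dy}{|x-y|^{n-\alpha}},\qquad v(x)=\int_{\mathbb{R}^n}\frac{u^p(y)\,dy}{|x-y|^{n-\alpha}}.$$ Suppose there exist $\theta_1,\theta_2>0$ such that $u(x)\simeq(1+|x|)^{-\theta_1}$ and $v(x)\simeq(1+|x|)^{-\theta_2}$ as $|x|\to\infty$. Then $\frac{1}{p+1}+\frac{1}{q+1}\le\frac{n-\alpha}{n}$, and $$\theta_1\ge\frac{\alpha(q+1)}{pq-1},\qquad \theta_2\ge\frac{\alpha(p+1)}{pq-1}.$$ Furthermore: (1) if at least one of these two inequalities is strict, then $\frac{1}{p+1}+\frac{1}{q+1}=\frac{n-\alpha}{n}$, $(u,v)\in L^{p+1}(\mathbb{R}^n)\times L^{q+1}(\mathbb{R}^n)$, and $u,v$ decay fast in the following sense: if $p\le q$, then $u(x)\simeq|x|^{\alpha-n}$, and $v(x)\simeq|x|^{\alpha-n}$ if $p(n-\alpha)>n$, $v(x)\simeq|x|^{\alpha-n}\ln|x|$ if $p(n-\alpha)=n$, $v(x)\simeq|x|^{(\alpha-n)(p+1)+n}$ if $p(n-\alpha)<n$; if $q\le p$, the same holds with the roles of $(u,p)$ and $(v,q)$ interchanged. (2) if $\frac{1}{p+1}+\frac{1}{q+1}<\frac{n-\alpha}{n}$, then $\theta_1=\frac{\alpha(q+1)}{pq-1}$ and 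$\theta_2=\frac{\alpha(p+1)}{pq-1}$.
   Context: Positive solutions are positive measurable functions satisfying both integral identities (finite) at every point. ''$f(x)\simeq g(x)$ as $|x|\to\infty$'' means there is $C>0$ with $g(x)/C\le f(x)\le Cg(x)$ for all sufficiently large $|x|$. *)

(* Defs.v *)
From HB Require Import structures.
From mathcomp Require Import all_boot all_order all_algebra.
From mathcomp Require Import all_classical all_reals all_analysis.
Set Implicit Arguments. Unset Strict Implicit. Unset Printing Implicit Defensive.
Import Order.TTheory GRing.Theory Num.Theory.
Import numFieldNormedType.Exports.
Local Open Scope classical_set_scope.
Local Open Scope ring_scope.

Section Rn.
Variable R : realType.

Definition enorm n (x : 'rV[R]_n) : R := Num.sqrt (\sum_(i < n) x ord0 i ^+ 2).

(* Borel sigma-algebra of R^n: generated by the coordinate cylinders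
   {x | x_i \in B}, B Borel in R (= product Borel sigma-algebra). *)
Definition Rn_measurable n : set (set 'rV[R]_n) :=
  <<s [set A | exists (i : 'I_n) (B : set (measurableTypeR R)),
                 measurable B /\ A = [set x : 'rV[R]_n | B (x ord0 i)]] >>.

Definition Rn_measurable_fun n (f : 'rV[R]_n -> R) : Prop :=
  forall B : set (measurableTypeR R), measurable B -> @Rn_measurable n (f @^-1` B).

(* Iterated Lebesgue integral over R^k of a function of the k coordinates
   (given as a list). For nonnegative measurable integrands it is, by
   Tonelli's theorem, the Lebesgue integral over R^k. *)
Fixpoint iter_integral (k : nat) (f : seq R -> \bar R) : \bar R :=
  match k with
  | 0 => f [::]
  | k'.+1 => (\int[@lebesgue_measure R]_t
                iter_integral k' (fun s => f (t :: s)))%E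
  end.

Definition Rn_integral n (f : 'rV[R]_n -> \bar R) : \bar R :=
  iter_integral n (fun s => f (\row_(i < n) nth 0 s i)).

Definition asymp_equiv n (f g : 'rV[R]_n -> R) : Prop :=
  exists C : R, 0 < C /\ exists R0 : R, forall x, R0 < enorm x ->
    g x / C <= f x /\ f x <= C * g x.

Definition positive_solution n (alpha p q : R) (u v : 'rV[R]_n -> R) : Prop :=
  (forall x, 0 < u x) /\ (forall x, 0 < v x) /\
  Rn_measurable_fun u /\ Rn_measurable_fun v /\
  (forall x, (u x)%:E = Rn_integral (fun y =>
       ((v y `^ q) * (enorm (x - y) `^ (alpha - n%:R)))%:E)) /\
  (forall x, (v x)%:E = Rn_integral (fun y =>
       ((u y `^ p) * (enorm (x - y) `^ (alpha - n%:R)))%:E)).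

Definition bounded_fun_Rn n (f : 'rV[R]_n -> R) : Prop :=
  exists M : R, forall x, `|f x| <= M.

Definition in_Lr n (r : R) (f : 'rV[R]_n -> R) : Prop :=
  (Rn_integral (fun y => (`|f y| `^ r)%:E) < +oo)%E.

End Rn.

(* Main.v *)
(* If g is comparable to |x|^-s and its Riesz potential to |x|^-theta, then
   theta = min (s, n) - alpha, and s = n is excluded because |y|^-n is not integrable at infinity. Applied to both equations this
   leaves either the slow rates, or a fast solution. A solution with
   (p + 1) theta1 > n (every fast one, and the slow ones in the subcritical range)
   has finite energy E = int u^(p+1) = int v^(q+1), and a Pohozaev identity then
   forces criticality.

   No smoothness is available for the Pohozaev identity. It is obtained by
   expanding to first order at lambda = 1 both sides of
     int u^p(lambda x) u(x) dx = lambda^-alpha int v^q(y) v(lambda y) dy,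
   which only needs u(lambda x) = u(x) (1 + O(lambda - 1)) uniformly in x, and
   likewise for v. That Lipschitz bound comes from cutting the kernel at distance
   eps |x|: the far part is Lipschitz under dilations, with a constant depending on
   eps, while the near part is a small multiple of the whole potential, so the
   dilation moduli A of u and v satisfy A <= C |lambda - 1| + A / 2. *)
Require Import Defs.
From HB Require Import structures.
From mathcomp Require Import all_boot all_order all_algebra.
From mathcomp Require Import all_classical all_reals all_analysis.
From mathcomp Require Import measurable_realfun ring lra.
Set Implicit Arguments. Unset Strict Implicit. Unset Printing Implicit Defensive.
Import Order.TTheory GRing.Theory Num.Theory.
Local Open Scope classical_set_scope.
Local Open Scope ring_scope.

(** * Lebesgue measure on row vectors *)

(** The statement integrates one coordinate at a time, while the argument needs Tonelli on pairs of
    points and dilations of the whole space; the iterated integral is therefore identified with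
    integration against a product measure [leb]. Polar coordinates are replaced by self-similarity:
    a power of |x| is compared with its own dilate, and convergence or divergence is read off from
    the resulting factor.

    In the energy identity no derivative of u appears: with r = u(lambda x) / u(x), Young's
    inequality r^p <= p/(p+1) r^(p+1) + 1/(p+1) is an equality up to O((ln r)^2). Multiplied by
    u^(p+1), its right side involves only u^(p+1)(lambda x) and u^(p+1)(x), whose integrals are
    exact multiples of E. First-order terms then give n p/(p+1) = alpha + n/(q+1), which is
    criticality.

    Absorbing A / 2 requires a modulus known to be finite beforehand; it comes from the power
    bounds, which make u and v vary by a bounded factor on |y - x| <= |x| / 2.

    The logarithmic alternative of the conclusion is the excluded borderline s = n, since v is
    assumed comparable to a pure power. *)

Definition cylinders (R : realType) (n : nat) : set (set 'rV[R]_n) :=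
  [set A | exists (i : 'I_n) (B : set (measurableTypeR R)),
     measurable B /\ A = [set x : 'rV[R]_n | B (x ord0 i)]].

Arguments cylinders : clear implicits.

(** An alias that carries the sigma-algebra of the statement as a canonical measurable structure.
    The vector operations stay on the row-vector type, hence the casts in later formulas. *)
Definition Rn (R : realType) (n : nat) : Type := 'rV[R]_n.

Section measurable_Rn.
Variables (R : realType) (n : nat).
Let G : set (set (Rn R n)) := cylinders R n.

HB.instance Definition _ := Choice.copy (Rn R n) 'rV[R]_n.
HB.instance Definition _ := isPointed.Build (Rn R n) (0 : 'rV[R]_n).

Let Rn_measurableC (A : set (Rn R n)) : <<s G >> A -> <<s G >> (~` A).
Proof. by move=> sGA; rewrite -setTD; exact: sigma_algebraCD. Qed.

HB.instance Definition _ := @isMeasurable.Build (sigma_display G) (Rn R n)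
  <<s G >> (@sigma_algebra0 _ setT G) Rn_measurableC
  (@sigma_algebra_bigcup _ setT G).

End measurable_Rn.

Arguments Rn : clear implicits.

Section measure_on_Rn.
Context (R : realType).
Local Notation L := (@lebesgue_measure R).

Lemma measurable_coord n (i : 'I_n) :
  measurable_fun [set: Rn R n] (fun x : Rn R n => x ord0 i : measurableTypeR R).
Proof.
move=> _ B mB; rewrite setTI; apply: sub_sigma_algebra.
by exists i, B.
Qed.

Lemma measurable_to_Rn d (T : measurableType d) n (f : T -> Rn R n) :
  (forall i, measurable_fun [set: T] (fun t => f t ord0 i : measurableTypeR R)) ->
  measurable_fun [set: T] f.
Proof.
move=> mf; apply: (@measurability _ _ T (Rn R n) setT f (cylinders R n)) => //.
move=> _ [_ [i [B [mB ->]] <-]].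
exact: mf.
Qed.

(** Splits off the first coordinate, the one that [iter_integral] integrates outermost. *)
Definition consV n (z : measurableTypeR R * Rn R n) : Rn R n.+1 :=
  \row_(i < n.+1) oapp (fun j => z.2 ord0 j) z.1 (unlift ord0 i).

Definition unconsV n (x : Rn R n.+1) : measurableTypeR R * Rn R n :=
  (x ord0 ord0, \row_(j < n) x ord0 (lift ord0 j)).

Lemma consVK n : cancel (@consV n) (@unconsV n).
Proof.
move=> [t s]; rewrite /unconsV /consV /= mxE unlift_none; congr pair.
by apply/rowP => j; rewrite !mxE liftK.
Qed.

Lemma measurable_consV n : measurable_fun setT (@consV n).
Proof.
apply: measurable_to_Rn => i; rewrite /consV.
under eq_fun do rewrite mxE.
case: (unlift ord0 i) => [j|] /=; last exact: measurable_fst.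
exact: (measurableT_comp (measurable_coord _) measurable_snd).
Qed.

Lemma measurable_unconsV n : measurable_fun setT (@unconsV n).
Proof.
apply/measurable_fun_pair; first exact: measurable_coord.
apply: measurable_to_Rn => i /=.
by under eq_fun do rewrite mxE; exact: measurable_coord.
Qed.

Section step.
Context n (m1 : {sigma_finite_measure set (measurableTypeR R) -> \bar R})
  (m : {sigma_finite_measure set (Rn R n) -> \bar R}).

Definition Rn_step : set (Rn R n.+1) -> \bar R :=
  pushforward (m1 \x m)%E (@consV n).

Let Rn_step0 : Rn_step set0 = 0%E.
Proof. by rewrite /Rn_step /pushforward preimage_set0 measure0. Qed.

Let Rn_step_ge0 A : (0 <= Rn_step A)%E.
Proof. by rewrite /Rn_step /pushforward; exact: measure_ge0. Qed.

Let Rn_step_sigma_additive : semi_sigma_additive Rn_step.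
Proof.
move=> F mF tF mUF; rewrite /Rn_step /pushforward preimage_bigcup.
apply: measure_semi_sigma_additive.
- by move=> i; rewrite -[X in measurable X]setTI; exact: measurable_consV.
- apply/trivIsetP => /= i j _ _ ij; rewrite -preimage_setI.
  by move/trivIsetP : tF => /(_ _ _ _ _ ij) ->//; rewrite preimage_set0.
- by rewrite -preimage_bigcup -[X in measurable X]setTI; exact: measurable_consV.
Qed.

HB.instance Definition _ := isMeasure.Build _ _ _ Rn_step
  Rn_step0 Rn_step_ge0 Rn_step_sigma_additive.

Let Rn_step_sigma_finite : sigma_finite setT Rn_step.
Proof.
have /sigma_finiteP[F [TF ndF Foo]] := sigma_finiteT m1.
have /sigma_finiteP[G [TG ndG Goo]] := sigma_finiteT m.
exists (fun i => @unconsV n @^-1` (F i `*` G i)).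
  apply/esym; rewrite -preimage_bigcup -subTset => x _ /=.
  case: (unconsV x) => t s.
  have [i _ Fi] : (\bigcup_i F i) t by rewrite -TF.
  have [j _ Gj] : (\bigcup_j G j) s by rewrite -TG.
  exists (maxn i j) => //; split.
    by apply: (subsetPset _ _ (ndF _ _ (leq_maxl i j))).
  by apply: (subsetPset _ _ (ndG _ _ (leq_maxr i j))).
move=> i; have [mF Fi] := Foo i; have [mG Gi] := Goo i; split.
  by rewrite -[X in measurable X]setTI; apply: measurable_unconsV => //; exact: measurableX.
rewrite /Rn_step /pushforward (_ : _ @^-1` _ = F i `*` G i); last first.
  by apply/funext => z; exact: (congr1 (F i `*` G i) (consVK z)).
by rewrite product_measure1E// lte_mul_pinfty// ge0_fin_numE.
Qed.

HB.instance Definition _ := Measure_isSigmaFinite.Build _ _ _ Rn_step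
  Rn_step_sigma_finite.

End step.

Fixpoint leb n : {sigma_finite_measure set (Rn R n) -> \bar R} :=
  match n with
  | 0 => [the {sigma_finite_measure set (Rn R 0) -> \bar R} of
          (@dirac _ (Rn R 0) (0%R : 'rV[R]_0) R)]
  | n'.+1 => [the {sigma_finite_measure set (Rn R n'.+1) -> \bar R} of Rn_step L (leb n')]
  end.

Local Open Scope ereal_scope.

Lemma integral_leb0 (f : Rn R 0 -> \bar R) : measurable_fun setT f ->
  \int[leb 0]_x f x = f (0%R : 'rV[R]_0).
Proof. by move=> mf; rewrite integral_dirac// diracT mul1e. Qed.

Lemma integral_lebS n (f : Rn R n.+1 -> \bar R) : measurable_fun setT f ->
  (forall x, 0 <= f x) ->
  \int[leb n.+1]_x f x = \int[L]_t \int[leb n]_s f (consV (t, s)).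
Proof.
move=> mf f0; rewrite ge0_integral_pushforward//; last exact: measurable_consV.
have mfc : measurable_fun setT (f \o @consV n).
  by apply: measurableT_comp => //; exact: measurable_consV.
by rewrite preimage_setT (fubini_tonelli1 _ mfc)//= => z; exact: f0.
Qed.

(** The bridge from the iterated integral of the statement to a measure on the whole space: by
    Tonelli, each step of the recursion peels off one factor of the product. *)
Lemma Rn_integralE n (f : Rn R n -> \bar R) : measurable_fun setT f ->
  (forall x, 0 <= f x) -> Rn_integral f = \int[leb n]_x f x.
Proof.
rewrite /Rn_integral; elim: n f => [|n IH] f mf f0.
  rewrite integral_leb0//=; congr f; apply/rowP => -[]//.
rewrite integral_lebS//=; apply: eq_integral => t _.
rewrite -(IH (fun s => f (consV (t, s)))) //; last first.
  apply: (measurableT_comp mf).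
  apply: (measurableT_comp (@measurable_consV n)).
  by apply/measurable_fun_pair => //; exact: measurable_cst.
congr iter_integral; apply/funext => s; congr f; apply/rowP => i.
by rewrite !mxE; case: unliftP => [j|] -> //=; rewrite mxE.
Qed.

Local Close Scope ereal_scope.

(** [c] times the image of Lebesgue measure under t -> c t + b gives every half-open interval its
    length, so it is Lebesgue measure by uniqueness. *)
Lemma integral_affine1 (c b : R) (f : measurableTypeR R -> \bar R) : 0 < c ->
  measurable_fun setT f -> (forall x, (0 <= f x)%E) ->
  (\int[L]_t f (c * t + b)%R = (c^-1)%:E * \int[L]_t f t)%E.
Proof.
move=> c0 mf f0; pose phi (t : measurableTypeR R) : measurableTypeR R := c * t + b.
have mphi : measurable_fun setT phi.
  by apply: measurable_funD => //; exact: measurable_funM.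
pose mu : {measure set (measurableTypeR R) -> \bar R} :=
  measure_function_pushforward__canonical__measure_function_Measure L mphi.
pose k : {nonneg R} := NngNum (ltW c0).
have muE A : measurable A -> L A = mscale k mu A.
  apply: lebesgue_measure_unique => //= _ [[x y]] _ <-.
  have -> : mscale k mu `]x, y]%classic = (c%:E * L (phi @^-1` `]x, y]%classic))%E by [].
  have -> : phi @^-1` `]x, y]%classic = `](x - b) / c, (y - b) / c]%classic.
    apply/seteqP; split => t; rewrite /= !in_itv /= /phi => /andP[h1 h2]; apply/andP.
      by rewrite ltr_pdivrMr// ler_pdivlMr//; split; lra.
    by move: h1 h2; rewrite ltr_pdivrMr// ler_pdivlMr// => h1 h2; split; lra.
  rewrite !lebesgue_measure_itv /= !lte_fin ltr_pM2r ?invr_gt0// ltrD2r.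
  case: ifPn => _; rewrite ?mule0// -!EFinD -EFinM; congr EFin.
  by field; exact: lt0r_neq0.
have -> : (\int[L]_t f (c * t + b)%R = \int[mu]_t f t)%E.
  by rewrite ge0_integral_pushforward// preimage_setT.
have -> : (\int[L]_t f t = \int[mscale k mu]_t f t)%E.
  by apply: eq_measure_integral => A mA _; exact: muE.
rewrite ge0_integral_mscale// muleA -EFinM /= mulVf ?mul1e//.
exact: lt0r_neq0.
Qed.

Lemma consV_affine n (c : R) (b : Rn R n.+1) (t : R) (s : Rn R n) :
  c *: (consV (t, s) : 'rV_n.+1) + b =
  consV (c * t + (unconsV b).1, c *: (s : 'rV_n) + (unconsV b).2).
Proof.
apply/rowP => i; rewrite !mxE /=.
by case: unliftP => [j|] -> //=; rewrite !mxE.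
Qed.

Lemma measurable_affine n (c : R) (b : Rn R n) :
  measurable_fun setT (fun x : Rn R n => c *: (x : 'rV_n) + b : Rn R n).
Proof.
apply: measurable_to_Rn => i; under eq_fun do rewrite !mxE.
apply: measurable_funD => //; apply: measurable_funM => //.
exact: measurable_coord.
Qed.

(** The map acts on each coordinate separately, so induction on the dimension collects one factor
    1/c per coordinate. *)
Lemma integral_affine n (c : R) (b : Rn R n) (f : Rn R n -> \bar R) : 0 < c ->
  measurable_fun setT f -> (forall x, (0 <= f x)%E) ->
  (\int[leb n]_x f (c *: (x : 'rV_n) + b)%R = (c^-1 ^+ n)%:E * \int[leb n]_x f x)%E.
Proof.
move=> c0; elim: n b f => [|n IH] b f mf f0.
  rewrite integral_leb0; last exact: (measurableT_comp mf (measurable_affine c b)).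
  rewrite integral_leb0// expr0 mul1e; congr f.
  by apply/rowP => -[].
rewrite integral_lebS//; last exact: (measurableT_comp mf (measurable_affine c b)).
rewrite integral_lebS//.
under eq_integral => t _ do under eq_integral => s _ do rewrite consV_affine.
have mfc : measurable_fun setT (fun z => f (consV z)).
  by apply: (measurableT_comp mf); exact: measurable_consV.
have mft t : measurable_fun setT (fun s => f (consV (t, s))).
  by apply: (measurableT_comp mfc); exact: measurable_pair1.
under eq_integral => t _ do rewrite (IH _ (fun s => f (consV (c * t + _, s))))//.
have mF : measurable_fun setT (fun t => (\int[leb n]_s f (consV (t, s)))%E).
  by apply: (measurable_fun_fubini_tonelli_F (fun z => f (consV z))).
rewrite ge0_integralZl; last 4 first.
- exact: measurableT.
- by apply: (measurableT_comp mF); apply: measurable_funD => //; exact: measurable_funM.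
- by move=> t _; exact: integral_ge0.
- by rewrite lee_fin exprn_ge0// invr_ge0 ltW.
rewrite (integral_affine1 (unconsV b).1 c0 mF); last by move=> t; exact: integral_ge0.
by rewrite muleA -EFinM exprSr.
Qed.

Lemma measurable_enorm n : measurable_fun setT (@enorm R n : Rn R n -> R).
Proof.
have msqrt : measurable_fun [set: R] (@Num.sqrt R).
  by apply: continuous_measurable_fun; exact: sqrt_continuous.
apply: (measurableT_comp msqrt).
apply: measurable_sum => i; apply: measurable_funX; exact: measurable_coord.
Qed.

Lemma measurable_sub_Rn d (T : measurableType d) n (f g : T -> Rn R n) :
  measurable_fun setT f -> measurable_fun setT g ->
  measurable_fun setT (fun t => (f t : 'rV_n) - g t : Rn R n).
Proof.
move=> mf mg; apply: measurable_to_Rn => i; under eq_fun do rewrite !mxE.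
by apply: measurable_funB; exact: (measurableT_comp (measurable_coord i)).
Qed.

Lemma measurable_sublevel d (T : measurableType d) (f : T -> R) (a : R) :
  measurable_fun setT f -> measurable [set x | f x <= a].
Proof.
move=> mf; rewrite (_ : [set x | _] = setT `&` f @^-1` `]-oo, a]%classic).
  exact: (mf measurableT _ (measurable_itv _)).
by rewrite setTI; apply/seteqP; split => x; rewrite /= in_itv.
Qed.

Definition cube n (a : R) : set (Rn R n) := [set x | forall i, `|x ord0 i| <= a].

Lemma measurable_cube n (a : R) : measurable (@cube n a).
Proof.
rewrite (_ : @cube n a = \bigcap_(i in [set: 'I_n]) [set x | `|x ord0 i| <= a]).
  apply: fin_bigcap_measurable => // i _; apply: measurable_sublevel.
  by apply: measurableT_comp => //; exact: measurable_coord.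
by apply/seteqP; split => [x h i _|x h i]; [exact: h|exact: (h i)].
Qed.

Lemma leb_cube n (a : R) : 0 <= a -> leb n (@cube n a) = ((2 * a) ^+ n)%:E.
Proof.
rewrite /cube => a0.
elim: n => [|n IH].
  rewrite /= diracE mem_set//; by case.
have -> : leb n.+1 [set x : Rn R n.+1 | forall i, `|x ord0 i| <= a] =
   (L \x leb n)%E (`[-a, a]%classic `*` [set x : Rn R n | forall i, `|x ord0 i| <= a]).
  rewrite /= /Rn_step /pushforward; congr product_measure1; apply/seteqP.
  split => -[t s] /=; rewrite in_itv /= -ler_norml.
    by move=> h; split=> [|i]; [have := h ord0|have := h (lift ord0 i)];
      rewrite mxE ?unlift_none ?liftK.
  by move=> [h1 h2] i; rewrite mxE; case: unliftP => [j|] _ /=.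
rewrite product_measure1E//; last exact: measurable_cube.
rewrite IH exprS EFinM; congr (_ * _)%E.
have /= -> := lebesgue_measure_itv `[-a, a]; rewrite lte_fin.
case: ifPn => h; first by rewrite -EFinD; congr EFin; lra.
by congr EFin; lra.
Qed.

(** The point lies in the null hyperplane fixing its first coordinate. The dimension must be
    positive: in dimension 0 the measure is a Dirac mass. *)
Lemma leb_set1 n (a : Rn R n.+1) : (leb n.+1).-negligible [set a].
Proof.
exists [set x : Rn R n.+1 | x ord0 ord0 = a ord0 ord0]; split.
- rewrite -[X in measurable X]setTI.
  exact: (measurable_coord ord0 measurableT (measurable_set1 (a ord0 ord0))).
- rewrite /= /Rn_step /pushforward.
  rewrite (_ : _ @^-1` _ = [set (a ord0 ord0 : measurableTypeR R)] `*` setT).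
    rewrite product_measure1E//.
    rewrite -[RHS](mul0e (leb n setT)); congr (_ * _)%E.
    exact: lebesgue_measure_set1.
  by apply/seteqP; split => -[t s] /=; rewrite mxE unlift_none //= => -[].
- by move=> x ->.
Qed.

End measure_on_Rn.

(** * Euclidean norm and integration *)

Section euclidean_norm.
Context (R : realType) (n : nat).
Implicit Types x y : 'rV[R]_n.

Lemma enorm_ge0 x : 0 <= enorm x.
Proof. exact: sqrtr_ge0. Qed.

Lemma sqr_enorm x : enorm x ^+ 2 = \sum_(i < n) x ord0 i ^+ 2.
Proof. by rewrite sqr_sqrtr// sumr_ge0// => i _; exact: sqr_ge0. Qed.

Lemma coord_le_enorm x i : `|x ord0 i| <= enorm x.
Proof.
rewrite -(@ler_pXn2r _ 2)// ?nnegrE// ?enorm_ge0//.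
rewrite sqr_enorm real_normK ?num_real// (bigD1 i)//= lerDl.
by rewrite sumr_ge0// => j _; exact: sqr_ge0.
Qed.

Lemma enorm0 : enorm (0 : 'rV[R]_n) = 0.
Proof. by rewrite /enorm big1 ?sqrtr0// => i _; rewrite mxE expr0n. Qed.

Lemma enorm_eq0 x : (enorm x == 0) = (x == 0).
Proof.
apply/eqP/eqP => [x0|->]; last exact: enorm0.
apply/rowP => i; rewrite mxE; apply/eqP; rewrite -normr_le0.
by have := coord_le_enorm x i; rewrite x0.
Qed.

Lemma enorm_gt0 x : (0 < enorm x) = (x != 0).
Proof. by rewrite lt_def enorm_ge0 andbT enorm_eq0. Qed.

Lemma enormZ c x : enorm (c *: x) = `|c| * enorm x.
Proof.
rewrite /enorm -sqrtr_sqr -sqrtrM ?sqr_ge0// mulr_sumr.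
by congr Num.sqrt; apply: eq_bigr => i _; rewrite mxE exprMn.
Qed.

Lemma enormN x : enorm (- x) = enorm x.
Proof. by rewrite -scaleN1r enormZ normrN1 mul1r. Qed.

Lemma enormC x y : enorm (x - y) = enorm (y - x).
Proof. by rewrite -enormN opprB. Qed.

(** Cauchy-Schwarz: with s = |x|, t = |y| and d the scalar product, the sum of the squares of t x_i
    - s y_i equals 2 s t (s t - d). *)
Lemma dot_le_enorm x y :
  \sum_(i < n) x ord0 i * y ord0 i <= enorm x * enorm y.
Proof.
have [x0|x0] := eqVneq x 0.
  by rewrite x0 enorm0 mul0r big1// => i _; rewrite mxE mul0r.
have [y0|y0] := eqVneq y 0.
  by rewrite y0 enorm0 mulr0 big1// => i _; rewrite mxE mulr0.
set s := enorm x; set t := enorm y; set d := \sum_(i < n) _.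
have s0 : 0 < s by rewrite enorm_gt0.
have t0 : 0 < t by rewrite enorm_gt0.
have : 0 <= \sum_(i < n) (t * x ord0 i - s * y ord0 i) ^+ 2.
  by apply: sumr_ge0 => i _; exact: sqr_ge0.
have -> : \sum_(i < n) (t * x ord0 i - s * y ord0 i) ^+ 2 =
    t ^+ 2 * s ^+ 2 - 2 * s * t * d + s ^+ 2 * t ^+ 2.
  rewrite /s /t !sqr_enorm -/s -/t /d !mulr_sumr -sumrB -big_split /=.
  rewrite -[in RHS]/s; apply: eq_bigr => i _.
  by rewrite -!sqr_enorm -/s -/t; ring.
move=> h; have : 0 <= (2 * s * t) * (s * t - d) by nra.
by rewrite pmulr_rge0 ?subr_ge0// !mulr_gt0.
Qed.

Lemma enormD x y : enorm (x + y) <= enorm x + enorm y.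
Proof.
rewrite -(@ler_pXn2r _ 2)// ?nnegrE ?addr_ge0 ?enorm_ge0//.
have -> : enorm (x + y) ^+ 2 = enorm x ^+ 2 + enorm y ^+ 2 +
    2 * \sum_(i < n) x ord0 i * y ord0 i.
  rewrite !sqr_enorm mulr_sumr -!big_split/=; apply: eq_bigr => i _.
  by rewrite !mxE; ring.
by have := dot_le_enorm x y; nra.
Qed.

Lemma enormB_le x y : enorm x <= enorm (x - y) + enorm y.
Proof. by rewrite -{1}(subrK y x) enormD. Qed.

Lemma enorm_exists (r : R) : (0 < n)%N -> 0 <= r ->
  exists x : 'rV[R]_n, enorm x = r.
Proof.
move=> n0 r0; pose e : 'rV[R]_n := \row_j (j == Ordinal n0)%:R.
exists (r *: e); rewrite enormZ ger0_norm//.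
suff -> : enorm e = 1 by rewrite mulr1.
rewrite /enorm (bigD1 (Ordinal n0))//= mxE eqxx expr1n big1 ?addr0 ?sqrtr1//.
by move=> i /negbTE; rewrite mxE => ->; rewrite expr0n.
Qed.

End euclidean_norm.

Section integrals.
Context (R : realType) (n : nat) (n_gt0 : (0 < n)%N).
Implicit Types f g : Rn R n -> R.

Local Notation J f := (\int[leb R n]_x (f x)%:E)%E.
Local Notation mfun f := (measurable_fun [set: Rn R n] f).

Lemma J_ge0 f : (forall x, 0 <= f x) -> (0 <= J f)%E.
Proof. by move=> f0; apply: integral_ge0 => x _; rewrite lee_fin. Qed.

(* The exceptional point [a] absorbs the junk value [0 `^ e = 0] of singular kernels. *)
Lemma le_J (a : Rn R n) f g : mfun f -> mfun g ->
  (forall x, 0 <= f x) -> (forall x, 0 <= g x) ->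
  (forall x, x <> a -> f x <= g x) -> (J f <= J g)%E.
Proof.
move=> mf mg f0 g0 fg; apply: ae_ge0_le_integral => //.
- by move=> x _; rewrite lee_fin.
- exact/measurable_EFinP.
- by move=> x _; rewrite lee_fin.
- exact/measurable_EFinP.
have [N [mN N0 aN]] : (leb R n).-negligible [set a].
  by move: a {f g mf mg f0 g0 fg}; case: n n_gt0 => // m _ a; exact: leb_set1.
exists N; split => // x /= h; apply: aN => /=; apply: contrapT => xa.
by apply: h => _; rewrite lee_fin; exact: fg.
Qed.

Lemma JZ c f : mfun f -> (forall x, 0 <= f x) -> 0 <= c ->
  (J (fun x => c * f x)%R = c%:E * J f)%E.
Proof.
move=> mf f0 c0; under eq_integral do rewrite EFinM.
rewrite ge0_integralZl//; first exact/measurable_EFinP.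
by move=> x _; rewrite lee_fin.
Qed.

Lemma JD f g : mfun f -> mfun g ->
  (forall x, 0 <= f x) -> (forall x, 0 <= g x) ->
  (J (fun x => f x + g x)%R = J f + J g)%E.
Proof.
move=> mf mg f0 g0; under eq_integral do rewrite EFinD.
rewrite ge0_integralD//.
- by move=> x _; rewrite lee_fin.
- exact/measurable_EFinP.
- by move=> x _; rewrite lee_fin.
- exact/measurable_EFinP.
Qed.

Lemma J_affine c (b : 'rV[R]_n) f : mfun f -> (forall x, 0 <= f x) -> 0 < c ->
  (J (fun x => f (c *: (x : 'rV_n) + b)%R) = (c^-1 ^+ n)%:E * J f)%E.
Proof.
move=> mf f0 c0; rewrite (integral_affine b (f := EFin \o f))//.
exact/measurable_EFinP.
Qed.

Lemma J_scale c f : mfun f -> (forall x, 0 <= f x) -> 0 < c ->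
  (J (fun x => f (c *: (x : 'rV_n))%R) = (c^-1 ^+ n)%:E * J f)%E.
Proof.
move=> mf f0 c0; rewrite -(J_affine 0 mf f0 c0).
by apply: eq_integral => x _; rewrite addr0.
Qed.

Lemma J_shift (b : 'rV[R]_n) f : mfun f -> (forall x, 0 <= f x) ->
  (J (fun x => f ((x : 'rV_n) - b)%R) = J f)%E.
Proof.
move=> mf f0; have := J_affine (- b) mf f0 ltr01.
rewrite invr1 expr1n mul1e => <-.
by apply: eq_integral => x _; rewrite scale1r.
Qed.

Lemma J_swap (F : Rn R n -> Rn R n -> R) :
  measurable_fun [set: Rn R n * Rn R n] (fun z => F z.1 z.2) ->
  (forall x y, 0 <= F x y) ->
  (\int[leb R n]_x \int[leb R n]_y (F x y)%:E =
   \int[leb R n]_y \int[leb R n]_x (F x y)%:E)%E.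
Proof.
move=> mF F0.
apply: (fubini_tonelli (fun z : Rn R n * Rn R n => (F z.1 z.2)%:E)).
  exact/measurable_EFinP.
by move=> z; rewrite lee_fin.
Qed.

Lemma measurable_affine_comp c (b : 'rV[R]_n) f : mfun f ->
  mfun (fun x => f (c *: (x : 'rV_n) + b)).
Proof. by move=> mf; exact: (measurableT_comp mf (measurable_affine c b)). Qed.

Lemma measurable_scale_comp c f : mfun f -> mfun (fun x => f (c *: (x : 'rV_n))).
Proof.
move=> /(measurable_affine_comp c 0); apply: eq_measurable_fun => x _.
by rewrite addr0.
Qed.

Lemma measurable_dist (a : 'rV[R]_n) : mfun (fun x => enorm ((x : 'rV_n) - a)).
Proof.
have := measurable_affine_comp 1 (- a) (@measurable_enorm R n).
by apply: eq_measurable_fun => x _; rewrite scale1r.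
Qed.

Definition ball_fun (a : 'rV[R]_n) (r : R) (x : Rn R n) : R :=
  if enorm ((x : 'rV_n) - a) <= r then 1 else 0.

Lemma ball_fun_ge0 a r x : 0 <= ball_fun a r x.
Proof. by rewrite /ball_fun; case: ifP. Qed.

Lemma measurable_ball_fun a r : mfun (ball_fun a r).
Proof.
apply: measurable_fun_ifT => //; apply: measurable_fun_ler => //.
exact: measurable_dist.
Qed.

(** Scaling reduces every ball to the unit one, which contains the cube of half-side 1/n and lies in
    the cube of half-side 1. Only finiteness and positivity of [V] matter, so its value is not
    computed. *)
Lemma ball_volume : exists2 V : R, 0 < V &
  forall a r, 0 < r -> J (ball_fun a r) = (V * r ^+ n)%:E.
Proof.
have mb := measurable_ball_fun.
have scaled a r : 0 < r -> (J (ball_fun a r) = (r ^+ n)%:E * J (ball_fun 0 1))%E.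
  move=> r0; have ri0 : 0 < r^-1 by rewrite invr_gt0.
  rewrite -[r in (r ^+ n)%:E]invrK.
  rewrite -(J_affine (- (r^-1 *: a)) (mb 0 1) (ball_fun_ge0 0 1) ri0).
  apply: eq_integral => x _; rewrite /ball_fun subr0 -scalerBr enormZ.
  by rewrite gtr0_norm// ler_pdivrMl// mulr1.
have cubeE a : (J (\1_(@cube R n a)) = leb R n (@cube R n a))%E.
  by rewrite integral_indic ?setIT//; exact: measurable_cube.
have n0 : 0 < n%:R :> R by rewrite ltr0n.
have mc a : mfun (\1_(@cube R n a) : Rn R n -> R).
  by apply: measurable_indic; exact: measurable_cube.
have up : (J (ball_fun 0 1) <= (2 ^+ n)%:E)%E.
  rewrite -[2]mulr1 -(leb_cube n ler01) -cubeE; apply: (@le_J 0) => //.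
  - exact: ball_fun_ge0.
  - move=> x _; rewrite /ball_fun subr0; case: ifP => // h.
    rewrite indicE mem_set// => i; exact: le_trans (coord_le_enorm x i) h.
have lo : (((2 * n%:R^-1) ^+ n)%:E <= J (ball_fun 0 1))%E.
  rewrite -(leb_cube n)// ?invr_ge0//  -cubeE; apply: (@le_J 0) => //.
  - exact: ball_fun_ge0.
  - move=> x _; rewrite indicE.
    case: (boolP (x \in _)) => [/set_mem h|_]; last exact: ball_fun_ge0.
    rewrite /ball_fun subr0 ifT//.
    rewrite -(@ler_pXn2r _ 2)// ?nnegrE ?enorm_ge0// sqr_enorm expr1n.
    apply: (@le_trans _ _ (\sum_(i < n) n%:R^-1)).
      apply: ler_sum => i _; rewrite -real_normK ?num_real//.
      apply: (@le_trans _ _ (n%:R^-1 ^+ 2)).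
        by rewrite ler_pXn2r ?nnegrE ?invr_ge0.
      by rewrite expr2 ler_piMr ?invr_ge0// invf_le1// ler1n.
    by rewrite sumr_const card_ord -[X in X *+ _]mul1r -mulrnAl mulfV// gt_eqF.
have fin : J (ball_fun 0 1) \is a fin_num.
  by rewrite ge0_fin_numE ?(le_lt_trans up) ?ltry// J_ge0//; exact: ball_fun_ge0.
exists (fine (J (ball_fun 0 1))).
  rewrite -lte_fin fineK//; apply: lt_le_trans lo.
  by rewrite lte_fin exprn_gt0// mulr_gt0// invr_gt0.
by move=> a r r0; rewrite scaled// EFinM fineK// muleC.
Qed.

End integrals.

(** * Integrals of powers *)

Section powR_facts.
Context (R : realType).
Implicit Types x y p r : R.

Lemma le_powR2 p x y : 0 <= p -> 0 <= x -> x <= y -> x `^ p <= y `^ p.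
Proof.
move=> p0 x0 xy; apply: ge0_ler_powR => //; rewrite nnegrE//.
exact: le_trans xy.
Qed.

Lemma ge_powR2 p x y : p <= 0 -> 0 < x -> x <= y -> y `^ p <= x `^ p.
Proof.
move=> p0 x0 xy; have y0 := lt_le_trans x0 xy.
rewrite -(opprK p) powRN [x `^ _]powRN lef_pV2 ?posrE ?powR_gt0//.
by apply: le_powR2; rewrite ?oppr_ge0// ltW.
Qed.

Lemma powR_lt1 p x : 1 < x -> p < 0 -> x `^ p < 1.
Proof.
move=> x1 p0; have x0 : 0 < x by lra.
rewrite -(opprK p) powRN invf_lt1 ?powR_gt0//.
have : 1 `^ (- p) < x `^ (- p) by apply: gt0_ltr_powR; rewrite ?nnegrE; lra.
by rewrite powR1.
Qed.

Lemma powR_split p r x : x != 0 -> x `^ (p + r) = x `^ p * x `^ r.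
Proof. by move=> x0; rewrite powRD// x0 implybT. Qed.

Lemma powRV p x : 0 <= x -> x^-1 `^ p = x `^ (- p).
Proof. by move=> x0; rewrite -powR_inv1// -powRrM mulN1r. Qed.

End powR_facts.

Section power_integrals.
Context (R : realType) (n : nat) (n_gt0 : (0 < n)%N).
Implicit Types f g : Rn R n -> R.

Local Notation J f := (\int[leb R n]_x (f x)%:E)%E.
Local Notation mfun f := (measurable_fun [set: Rn R n] f).

Lemma measurable_powR_comp p f : mfun f -> mfun (fun x => f x `^ p).
Proof. by move=> mf; exact: (measurableT_comp (measurable_powR p) mf). Qed.

(** The truncations [f m] have finite integral, so the term with factor [rho] can be subtracted from
    both sides; the bound obtained is uniform in [m] and passes to [g] by monotone convergence. *)
Lemma J_absorb (f : nat -> Rn R n -> R) g (rho S : R) :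
  (forall m, mfun (f m)) -> (forall m x, 0 <= f m x) ->
  (forall x m k, (m <= k)%N -> f m x <= f k x) ->
  (forall x, exists m, forall k, (m <= k)%N -> f k x = g x) ->
  (forall m, J (f m) < +oo)%E ->
  (forall m, J (f m) <= rho%:E * J (f m) + S%:E)%E ->
  rho < 1 -> (J g <= (S / (1 - rho))%:E)%E.
Proof.
move=> mf f0 ndf fg foo fle rho1.
have mEf m : measurable_fun setT (fun x => (f m x)%:E) by exact/measurable_EFinP.
have nd x m k : (m <= k)%N -> ((f m x)%:E <= (f k x)%:E)%E.
  by move=> mk; rewrite lee_fin ndf.
have -> : J g = (\int[leb R n]_x limn (fun m => (f m x)%:E))%E.
  apply: eq_integral => x _; apply/esym/cvg_lim => //.
  apply: cvg_near_cst; have [m hm] := fg x.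
  by exists m => // k /= mk; rewrite (hm _ mk).
rewrite (@monotone_convergence _ _ _ _ _ measurableT (fun m x => (f m x)%:E)); last 3 first.
- exact: mEf.
- by move=> m x _; rewrite lee_fin.
- by move=> x _ m k; exact: nd.
apply: lime_le.
  apply: ereal_nondecreasing_is_cvgn => m k mk; apply: ge0_le_integral => //.
  - by move=> x _; rewrite lee_fin.
  - by move=> x _; exact: nd.
apply: nearW => m.
have fin : J (f m) \is a fin_num by rewrite ge0_fin_numE// J_ge0.
have := fle m; rewrite -(fineK fin) -EFinM -EFinD !lee_fin => h.
by rewrite ler_pdivlMr ?subr_gt0//; lra.
Qed.

(** The substitute for integration in polar coordinates: [f m] is dominated by [A] times its own
    dilate plus an integrable remainder, and the dilation multiplies the integral by c^(-n), leaving
    a factor below 1 to absorb. *)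
Lemma J_self_similar_fin (f : nat -> Rn R n -> R) (g h : Rn R n -> R) (A c : R) :
  0 <= A -> 0 < c -> A * c^-1 ^+ n < 1 ->
  (forall m, mfun (f m)) -> (forall m x, 0 <= f m x) ->
  (forall x m k, (m <= k)%N -> f m x <= f k x) ->
  (forall x, exists m, forall k, (m <= k)%N -> f k x = g x) ->
  (forall m, J (f m) < +oo)%E ->
  mfun h -> (forall x, 0 <= h x) -> (J h < +oo)%E ->
  (forall m x, f m x <= A * f m (c *: (x : 'rV_n)) + h x) ->
  (J g < +oo)%E.
Proof.
move=> A0 c0 Ac mf f0 ndf fg foo mh h0 hoo le_f.
have hfin : J h \is a fin_num by rewrite ge0_fin_numE// J_ge0.
apply: (@le_lt_trans _ _ (fine (J h) / (1 - A * c^-1 ^+ n))%:E); last exact: ltry.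
apply: (J_absorb mf) => // m; rewrite fineK//.
have mfc := measurable_scale_comp c (mf m).
rewrite EFinM -muleA -J_scale// -JZ// -JD//; last 2 first.
- exact: measurable_funM.
- by move=> x; rewrite mulr_ge0.
apply: (le_J n_gt0 (a := 0 : 'rV_n)) => //.
- by apply: measurable_funD => //; exact: measurable_funM.
- by move=> x; rewrite addr_ge0// mulr_ge0.
Qed.

Lemma J_ball_lty (a : 'rV[R]_n) (C r : R) : 0 <= C -> 0 < r ->
  (J (fun x => C * ball_fun a r x)%R < +oo)%E.
Proof.
move=> C0 r0; have [V V0 HV] := ball_volume R n_gt0.
rewrite JZ ?HV//; [exact: ltry|exact: measurable_ball_fun|exact: ball_fun_ge0].
Qed.

Definition inner_pow (a : R) (x : Rn R n) : R :=
  if enorm x <= 1 then enorm x `^ (- a) else 0.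

Definition outer_pow (b : R) (x : Rn R n) : R :=
  if enorm x <= 1 then 0 else enorm x `^ (- b).

Lemma measurable_inner_pow a : mfun (inner_pow a).
Proof.
apply: measurable_fun_ifT => //.
  by apply: measurable_fun_ler => //; exact: measurable_enorm.
by apply: measurable_powR_comp; exact: measurable_enorm.
Qed.

Lemma measurable_outer_pow b : mfun (outer_pow b).
Proof.
apply: measurable_fun_ifT => //.
  by apply: measurable_fun_ler => //; exact: measurable_enorm.
by apply: measurable_powR_comp; exact: measurable_enorm.
Qed.

Lemma inner_pow_ge0 a x : 0 <= inner_pow a x.
Proof. by rewrite /inner_pow; case: ifP => // _; exact: powR_ge0. Qed.

Lemma outer_pow_ge0 b x : 0 <= outer_pow b x.
Proof. by rewrite /outer_pow; case: ifP => // _; exact: powR_ge0. Qed.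

Lemma inner_pow_lty (a : R) : 0 < a -> a < n%:R -> (J (inner_pow a) < +oo)%E.
Proof.
move=> a0 an.
pose f m (x : Rn R n) := if enorm x <= 1 then Num.min (enorm x `^ (- a)) m%:R else 0 : R.
have two0 : 0 < 2 :> R by [].
have f0 m x : 0 <= f m x.
  by rewrite /f; case: ifP => // _; rewrite le_min powR_ge0 ler0n.
have mf m : mfun (f m).
  apply: measurable_fun_ifT => //.
    by apply: measurable_fun_ler => //; exact: measurable_enorm.
  by apply: measurable_minr => //; apply: measurable_powR_comp; exact: measurable_enorm.
(* Dilation by 2: where |2x| <= 1 the truncated power at x is at most 2^a times its value at 2x, and
   on the shell 1/2 < |x| <= 1 it is at most 2^a. The factor 2^(a - n) is below 1 because a < n. *)
apply: (@J_self_similar_fin f _ (fun x => 2 `^ a * ball_fun 0 1 x) (2 `^ a) 2) => //.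
- rewrite exprVn -powR_mulrn// -powRN -powR_split ?gt_eqF//.
  by apply: powR_lt1; lra.
- move=> x m k mk; rewrite /f; case: ifP => // _.
  by rewrite le_min !ge_min lexx ler_nat mk orbT.
- move=> x; exists (Num.truncn (enorm x `^ (- a))).+1 => k hk.
  rewrite /f /inner_pow; case: ifP => // _; apply/min_idPl.
  apply: ltW; apply: lt_le_trans (_ : (Num.truncn (enorm x `^ (- a))).+1%:R <= _).
    exact: truncnS_gt.
  by rewrite ler_nat.
- move=> m; apply: (@le_lt_trans _ _ (J (fun x => m%:R * ball_fun 0 1 x)%R)); last first.
    exact: J_ball_lty.
  apply: (le_J n_gt0 (a := 0 : 'rV_n)) => //.
  + by apply: measurable_funM => //; exact: measurable_ball_fun.
  + by move=> x; rewrite mulr_ge0// ball_fun_ge0.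
  + move=> x _; rewrite /f /ball_fun subr0; have [_|_] := leP (enorm x) 1.
      by rewrite mulr1 ge_min lexx orbT.
    by rewrite mulr0.
- by apply: measurable_funM => //; exact: measurable_ball_fun.
- by move=> x; rewrite mulr_ge0// ?ball_fun_ge0// powR_ge0.
- by apply: J_ball_lty => //; exact: powR_ge0.
- move=> m x; rewrite /f /ball_fun subr0 enormZ gtr0_norm//.
  have p1 : 2 `^ 0 <= 2 `^ a :> R by apply: ler_powR; lra.
  rewrite powRr0 in p1.
  have p0 : 0 < 2 `^ a :> R by lra.
  have [h1|h1] := leP (enorm x) 1; last by rewrite ifF ?mulr0 ?addr0//; lra.
  rewrite mulr1; have [h2|h2] := leP (2 * enorm x) 1; last first.
    rewrite mulr0 add0r ge_min; apply/orP; left.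
    rewrite -[2 in leRHS]invrK powRV ?invr_ge0//.
    by apply: ge_powR2; lra.
  rewrite -[leLHS]addr0; apply: lerD => //.
  rewrite powRM// ?enorm_ge0// minr_pMr ?(ltW p0)// mulrA -powR_split ?gt_eqF//.
  rewrite subrr powRr0 mul1r le_min !ge_min lexx /=; apply/orP; right.
  by rewrite ler_peMl.
Qed.

Lemma outer_pow_lty (b : R) : n%:R < b -> (J (outer_pow b) < +oo)%E.
Proof.
move=> nb; have two0 : 0 < 2 :> R by [].
have b0 : 0 < b by apply: le_lt_trans nb.
pose f m (x : Rn R n) := if enorm x <= m%:R then outer_pow b x else 0.
have f0 m x : 0 <= f m x by rewrite /f; case: ifP => // _; exact: outer_pow_ge0.
have mf m : mfun (f m).
  apply: measurable_fun_ifT => //.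
    by apply: measurable_fun_ler => //; exact: measurable_enorm.
  exact: measurable_outer_pow.
have outer1 x : outer_pow b x <= 1.
  rewrite /outer_pow; have [//|h] := leP (enorm x) 1.
  by apply: ltW; apply: powR_lt1; lra.
(* Dilation by 1/2: beyond |x| = 2 the power at x is 2^(-b) times its value at x/2, and the rest is
   bounded by the indicator of a ball. The factor is now 2^(n - b). *)
apply: (@J_self_similar_fin f _ (fun x => 1 * ball_fun 0 2 x) (2 `^ (- b)) 2^-1) => //.
- rewrite invrK -powR_mulrn// -powR_split ?gt_eqF//.
  by apply: powR_lt1; lra.
- move=> x m k mk; rewrite /f; case: ifP => [h|_]; last first.
    by case: ifP => // _; exact: outer_pow_ge0.
  by rewrite ifT// (le_trans h)// ler_nat.
- move=> x; exists (Num.truncn (enorm x)).+1 => k hk.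
  rewrite /f ifT//.
  apply: ltW; apply: lt_le_trans (_ : (Num.truncn (enorm x)).+1%:R <= _).
    exact: truncnS_gt.
  by rewrite ler_nat.
- move=> m; apply: (@le_lt_trans _ _ (J (fun x => 1 * ball_fun 0 m.+1%:R x)%R)); last first.
    exact: J_ball_lty.
  apply: (le_J n_gt0 (a := 0 : 'rV_n)) => //.
  + by apply: measurable_funM => //; exact: measurable_ball_fun.
  + by move=> x; rewrite mulr_ge0// ball_fun_ge0.
  + move=> x _; rewrite mul1r /f; case: ifP => [h|_]; last exact: ball_fun_ge0.
    rewrite /ball_fun subr0 ifT// (le_trans h)// ler_nat//.
- by apply: measurable_funM => //; exact: measurable_ball_fun.
- by move=> x; rewrite mulr_ge0// ball_fun_ge0.
- exact: J_ball_lty.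
- move=> m x; rewrite mul1r.
  have [h2|h2] := leP (enorm x) 2.
    rewrite [ball_fun _ _ _]ifT ?subr0// -[leLHS]add0r lerD//.
      by rewrite mulr_ge0 ?powR_ge0.
    by rewrite /f; case: ifP.
  rewrite -[leLHS]addr0 lerD ?ball_fun_ge0//.
  rewrite /f /outer_pow enormZ ger0_norm//.
  have [h|h] := leP (enorm x) m%:R; last first.
    by rewrite mulr_ge0 ?powR_ge0//; case: ifP => // _; case: ifP => // _; exact: powR_ge0.
  rewrite ifF; last by apply/negbTE; rewrite -ltNge; lra.
  rewrite ifT; last by have := ler0n R m; lra.
  rewrite ifF; last by apply/negbTE; rewrite -ltNge; lra.
  rewrite powRM// ?enorm_ge0// powRV// opprK mulrA -powR_split ?gt_eqF//.
  by rewrite addNr powRr0 mul1r.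
Qed.

End power_integrals.

(** * Upper bound for the Riesz potential of a power *)

Section riesz_decay.
Context (R : realType) (n : nat) (n_gt0 : (0 < n)%N).
Implicit Types f g w : Rn R n -> R.

Local Notation J f := (\int[leb R n]_x (f x)%:E)%E.
Local Notation mfun f := (measurable_fun [set: Rn R n] f).
Local Notation N := (n%:R).

Lemma measurable_one_enorm p : mfun (fun x => (1 + enorm x) `^ p).
Proof.
by apply: measurable_powR_comp; apply: measurable_funD => //; exact: measurable_enorm.
Qed.

Lemma measurable_dist_powR (al : R) (x : 'rV[R]_n) :
  mfun (fun y => enorm (x - (y : 'rV_n)) `^ al).
Proof.
apply: measurable_powR_comp.
by under eq_fun do rewrite enormC; exact: measurable_dist.
Qed.

Lemma J_decay_lty b : N < b -> (J (fun x => (1 + enorm x) `^ (- b)) < +oo)%E.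
Proof.
move=> nb; have N0 : 0 < N :> R by rewrite ltr0n.
apply: (@le_lt_trans _ _ (J (fun x => 1 * ball_fun 0 1 x + outer_pow b x)%R)).
  apply: (le_J n_gt0 (a := 0 : 'rV_n)) => //.
  - exact: measurable_one_enorm.
  - apply: measurable_funD; last exact: measurable_outer_pow.
    by apply: measurable_funM => //; exact: measurable_ball_fun.
  - by move=> x; exact: powR_ge0.
  - by move=> x; rewrite mul1r addr_ge0 ?ball_fun_ge0 ?outer_pow_ge0.
  - move=> x _; rewrite mul1r /ball_fun /outer_pow subr0.
    have x0 := enorm_ge0 x; have [h|h] := leP (enorm x) 1; last first.
      by rewrite add0r; apply: ge_powR2; lra.
    rewrite addr0 powRN invf_le1 ?powR_gt0//; last lra.
    rewrite -[leLHS](powRr0 (1 + enorm x)); apply: ler_powR; lra.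
rewrite JD; first by apply: lte_add_pinfty; [exact: J_ball_lty|exact: outer_pow_lty].
- by apply: measurable_funM => //; exact: measurable_ball_fun.
- exact: measurable_outer_pow.
- by move=> x; rewrite mul1r ball_fun_ge0.
- exact: outer_pow_ge0.
Qed.

(** Jointly homogeneous of degree -a - b in (r, z): a singularity of order [a] at the origin and
    decay of order [a + b] at infinity, with the transition at |z| = r. *)
Definition two_pow (a b r : R) (z : Rn R n) : R :=
  enorm z `^ (- a) * (r + enorm z) `^ (- b).

Lemma two_pow_ge0 a b r z : 0 <= two_pow a b r z.
Proof. by rewrite mulr_ge0 ?powR_ge0. Qed.

Lemma measurable_two_pow a b r : mfun (two_pow a b r).
Proof.
apply: measurable_funM; apply: measurable_powR_comp; first exact: measurable_enorm.
by apply: measurable_funD => //; exact: measurable_enorm.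
Qed.

Lemma two_pow_lty a b : 0 < a -> a < N -> 0 <= b -> N < a + b ->
  (J (two_pow a b 1) < +oo)%E.
Proof.
move=> a0 aN b0 abN.
apply: (@le_lt_trans _ _ (J (fun x => inner_pow a x + outer_pow (a + b) x)%R)).
  apply: (le_J n_gt0 (a := 0 : 'rV_n)) => //.
  - exact: measurable_two_pow.
  - by apply: measurable_funD; [exact: measurable_inner_pow|exact: measurable_outer_pow].
  - exact: two_pow_ge0.
  - by move=> x; rewrite addr_ge0 ?inner_pow_ge0 ?outer_pow_ge0.
  - move=> x /eqP xn0; rewrite /two_pow /inner_pow /outer_pow.
    have x0 : 0 < enorm x by rewrite enorm_gt0.
    have [h|h] := leP (enorm x) 1.
      rewrite addr0 ler_piMr ?powR_ge0// powRN invf_le1 ?powR_gt0//; last lra.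
      rewrite -[leLHS](powRr0 (1 + enorm x)); apply: ler_powR; lra.
    rewrite add0r opprD powR_split ?gt_eqF// ler_wpM2l ?powR_ge0//.
    by apply: ge_powR2; lra.
rewrite JD; first by apply: lte_add_pinfty; [exact: inner_pow_lty|exact: outer_pow_lty].
- exact: measurable_inner_pow.
- exact: measurable_outer_pow.
- exact: inner_pow_ge0.
- exact: outer_pow_ge0.
Qed.

Lemma two_pow_scale a b r : 0 < r ->
  (J (two_pow a b r) = (r `^ (N - a - b))%:E * J (two_pow a b 1))%E.
Proof.
move=> r0; have ri0 : 0 < r^-1 by rewrite invr_gt0.
transitivity (J (fun z => r `^ (- a - b) * two_pow a b 1 (r^-1 *: (z : 'rV_n)))%R).
  apply: eq_integral => z _; congr EFin; rewrite /two_pow enormZ gtr0_norm//.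
  have -> : 1 + r^-1 * enorm z = r^-1 * (r + enorm z).
    by rewrite mulrDr mulVf ?gt_eqF.
  have z0 := enorm_ge0 z.
  rewrite !powRM//; [|lra..]; rewrite !powRV ?(ltW r0)// !opprK.
  have rV p : r `^ (- p) * r `^ p = 1.
    by rewrite -powR_split ?gt_eqF// addNr powRr0.
  rewrite powR_split ?gt_eqF//.
  set A := enorm z `^ _; set B := (r + enorm z) `^ _.
  rewrite [RHS](_ : _ = (r `^ (- a) * r `^ a) * (r `^ (- b) * r `^ b) * (A * B)).
    by rewrite !rV !mul1r.
  by ring.
have m1 := measurable_two_pow a b 1; have p1 := two_pow_ge0 a b 1.
rewrite JZ; [|exact: measurable_scale_comp|by move=> z; exact: p1|exact: powR_ge0].
rewrite (J_scale m1 p1 ri0) muleA -EFinM invrK.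
rewrite -(powR_mulrn _ (ltW r0)) -powR_split ?gt_eqF//.
by congr ((_ `^ _)%:E * _)%E; ring.
Qed.

Lemma le_powRN3 (X Y p : R) : 0 <= p -> 0 < X -> X <= 3 * Y ->
  Y `^ (- p) <= 3 `^ p * X `^ (- p).
Proof.
move=> p0 X0 XY; have Y0 : 0 < Y by lra.
have -> : Y `^ (- p) = 3 `^ p * (3 * Y) `^ (- p).
  rewrite powRM ?(ltW Y0)// mulrA -powR_split ?gt_eqF//.
  by rewrite subrr powRr0 mul1r.
by rewrite ler_wpM2l ?powR_ge0//; apply: ge_powR2; lra.
Qed.

(** If |y| <= |x - y| then |x| + |y| <= 3 |x - y|, and otherwise |x| + |x - y| <= 3 |y|. So the
    integrand is dominated by two functions [two_pow] with r = |x|, one centred at 0 and one at x,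
    both with integral a multiple of |x|^(al - s). Their convergence is exactly al < s < n. *)
Lemma riesz_upper al s : 0 < al -> al < s -> s < N ->
  exists2 C : R, 0 <= C & forall x : 'rV[R]_n, x != 0 ->
    (J (fun y => (1 + enorm y) `^ (- s) * enorm (x - (y : 'rV_n)) `^ (al - N))
     <= (C * enorm x `^ (al - s))%:E)%E.
Proof.
move=> al0 als sN.
have K1oo : (J (two_pow s (N - al) 1) < +oo)%E by apply: two_pow_lty; lra.
have K2oo : (J (two_pow (N - al) s 1) < +oo)%E by apply: two_pow_lty; lra.
have := J_ge0 (two_pow_ge0 s (N - al) 1).
have := J_ge0 (two_pow_ge0 (N - al) s 1).
have E1 := two_pow_scale s (N - al); have E2 := two_pow_scale (N - al) s.
move: K1oo K2oo E1 E2.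
case: (J (two_pow s (N - al) 1)) => // K1 _.
case: (J (two_pow (N - al) s 1)) => // K2 _ E1 E2; rewrite !lee_fin => K20 K10.
exists (3 `^ (N - al) * K1 + 3 `^ s * K2).
  by rewrite addr_ge0// mulr_ge0// powR_ge0.
move=> x x0; have r0 : 0 < enorm x by rewrite enorm_gt0.
pose F1 y := 3 `^ (N - al) * two_pow s (N - al) (enorm x) y.
pose F2 (y : Rn R n) := 3 `^ s * two_pow (N - al) s (enorm x) ((y : 'rV_n) - x).
have mt2 : mfun (fun y => two_pow (N - al) s (enorm x) ((y : 'rV_n) - x)).
  have := measurable_affine_comp 1 (- x) (measurable_two_pow (N - al) s (enorm x)).
  by apply: eq_measurable_fun => y _; rewrite scale1r.
have mF1 : mfun F1.
  by apply: measurable_funM; [exact: measurable_cst|exact: measurable_two_pow].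
have mF2 : mfun F2 by apply: measurable_funM; [exact: measurable_cst|exact: mt2].
have F10 y : 0 <= F1 y by rewrite mulr_ge0 ?powR_ge0 ?two_pow_ge0.
have F20 y : 0 <= F2 y by rewrite mulr_ge0 ?powR_ge0 ?two_pow_ge0.
apply: (@le_trans _ _ (J (fun y => F1 y + F2 y)%R)).
  apply: (le_J n_gt0 (a := 0 : 'rV_n)) => //.
  - by apply: measurable_funM; [exact: measurable_one_enorm|exact: measurable_dist_powR].
  - exact: (measurable_funD mF1 mF2).
  - by move=> y; rewrite mulr_ge0 ?powR_ge0.
  - by move=> y; exact: (addr_ge0 (F10 y) (F20 y)).
  move=> y /eqP y0; have A0 : 0 < enorm y by rewrite enorm_gt0.
  have [->|xy] := eqVneq (y : 'rV_n) x.
    rewrite subrr enorm0 powR0 ?mulr0 ?addr_ge0//.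
    by apply/negP => /eqP; lra.
  have B0 : 0 < enorm (x - (y : 'rV_n)) by rewrite enorm_gt0 subr_eq0 eq_sym.
  have tri : enorm x <= enorm (x - (y : 'rV_n)) + enorm y := enormB_le x y.
  have le1 : (1 + enorm y) `^ (- s) <= enorm y `^ (- s) by apply: ge_powR2; lra.
  rewrite -(opprB N al).
  have [AB|BA] := leP (enorm y) (enorm (x - (y : 'rV_n))).
    apply: (@le_trans _ _ (F1 y)); last by rewrite lerDl; exact: F20.
    apply: (le_trans (ler_wpM2r (powR_ge0 _ _) le1)).
    rewrite /F1 /two_pow mulrCA ler_wpM2l ?powR_ge0//.
    by apply: le_powRN3; lra.
  apply: (@le_trans _ _ (F2 y)); last by rewrite lerDr; exact: F10.
  apply: (le_trans (ler_wpM2r (powR_ge0 _ _) le1)).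
  rewrite /F2 /two_pow -(enormC x) mulrC mulrCA ler_wpM2l ?powR_ge0//.
  by apply: le_powRN3; lra.
rewrite (JD mF1 mF2 F10 F20).
have m1 := measurable_two_pow s (N - al) (enorm x).
have m2 := measurable_two_pow (N - al) s (enorm x).
have p1 := two_pow_ge0 s (N - al) (enorm x).
have p2 := two_pow_ge0 (N - al) s (enorm x).
rewrite (JZ m1 p1 (powR_ge0 _ _)) (JZ mt2 (fun y => p2 _) (powR_ge0 _ _)).
rewrite (J_shift x m2 p2) (E1 _ r0) (E2 _ r0) -!EFinM -EFinD lee_fin.
have -> : N - s - (N - al) = al - s by ring.
have -> : N - (N - al) - s = al - s by ring.
by rewrite le_eqVlt; apply/orP; left; apply/eqP; ring.
Qed.

End riesz_decay.

(** * Decay exponents of Riesz potentials *)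

Section exponents.
Context (R : realType) (n : nat) (n_gt0 : (0 < n)%N).
Implicit Types f g w : Rn R n -> R.

Local Notation J f := (\int[leb R n]_x (f x)%:E)%E.
Local Notation mfun f := (measurable_fun [set: Rn R n] f).
Local Notation N := (n%:R).
Local Notation "<| x |>" := (1 + enorm x).

(** Unlike [asymp_equiv], the bounds hold at every point with a single constant, as estimates under
    the integral require. *)
Definition comparable_pow f (th : R) := exists2 C : R, 0 < C &
  forall x : Rn R n, <|x|> `^ (- th) / C <= f x /\ f x <= C * <|x|> `^ (- th).

Definition riesz_of (al : R) g w := forall x : Rn R n,
  ((w x)%:E = J (fun y => g y * enorm ((x : 'rV_n) - (y : 'rV_n)) `^ (al - N)))%E.

Lemma bracket_gt0 (x : 'rV[R]_n) : 0 < <|x|>.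
Proof. by have := enorm_ge0 x; lra. Qed.

Lemma le_powR_double (e X Y : R) : 0 < X -> 0 < Y -> X <= 2 * Y -> Y <= 2 * X ->
  X `^ e <= 2 `^ `|e| * Y `^ e.
Proof.
move=> X0 Y0 XY YX; have [e0|e0] := leP 0 e.
  by rewrite ger0_norm// -powRM ?(ltW Y0)//; apply: le_powR2 => //; lra.
rewrite ltr0_norm//.
have -> : 2 `^ (- e) * Y `^ e = (2^-1 * Y) `^ e.
  by rewrite powRM ?(ltW Y0)// powRV.
by apply: ge_powR2; lra.
Qed.

(** Turns a comparison of powers at all large radii into a comparison of exponents. *)
Lemma exponent_le (a b A : R) :
  (forall r, 2 <= r -> r `^ a <= A * r `^ b) -> a <= b.
Proof.
move=> h; rewrite leNgt; apply/negP => ba.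
have e0 : 0 < a - b by lra.
(* [K] exceeds [A], and [r] is large enough for r^(a - b) to reach [K]; the 2 in [K] makes it
   nonnegative whatever the sign of [A]. *)
pose K := Num.max (A + 1) 2; pose r := Num.max 2 (K `^ (a - b)^-1).
have K0 : 0 <= K by rewrite /K le_max; apply/orP; right.
have r2 : 2 <= r by rewrite /r le_max lexx.
have r0 : 0 < r by lra.
have rK : K <= r `^ (a - b).
  rewrite -[leLHS]powRr1// -(@mulVf _ (a - b)) ?gt_eqF// powRrM.
  apply: le_powR2; [exact: ltW|exact: powR_ge0|].
  by rewrite /r le_max lexx orbT.
have := h r r2; rewrite -[in leLHS](subrK b a) powR_split ?gt_eqF//.
rewrite ler_pM2r ?powR_gt0// => le.
have : A + 1 <= K by rewrite /K le_max lexx.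
by lra.
Qed.

Lemma measurable_riesz_integrand al g (x : 'rV[R]_n) : mfun g ->
  mfun (fun y => g y * enorm (x - (y : 'rV_n)) `^ (al - N)).
Proof.
move=> mg; apply: measurable_funM; first exact: mg.
exact: (measurable_dist_powR (al - N) x).
Qed.

Context (al : R) (al_gt0 : 0 < al) (al_ltN : al < N).

(** The source of all lower bounds: discard everything outside a ball on which [g] is at least [m]
    and the kernel at least d^(al - n). The constant [V] is that of the ball volume, independent of
    all data. *)
Lemma riesz_ge_ball : exists2 V : R, 0 < V &
  forall g w (z : 'rV[R]_n) (r m d : R) (x : 'rV[R]_n), mfun g ->
  (forall y, 0 <= g y) -> riesz_of al g w -> 0 < r -> 0 <= m ->
  (forall y : 'rV[R]_n, enorm (y - z) <= r -> m <= g y /\ enorm (x - y) <= d) ->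
  V * r ^+ n * m * d `^ (al - N) <= w x.
Proof.
have alN := al_ltN; have [V V0 HV] := ball_volume R n_gt0; exists V => //.
move=> g w z r m d x mg g0 pot r0 m0 H.
rewrite -lee_fin (pot x) [_ * m * _](_ : _ = (m * d `^ (al - N)) * (V * r ^+ n)); last by ring.
have c0 : 0 <= m * d `^ (al - N) by rewrite mulr_ge0 ?powR_ge0.
rewrite EFinM -(HV z r r0) -JZ//; last 2 first.
- exact: measurable_ball_fun.
- exact: ball_fun_ge0.
apply: (le_J n_gt0 (a := x)) => //.
- by apply: measurable_funM => //; exact: measurable_ball_fun.
- exact: measurable_riesz_integrand.
- by move=> y; rewrite mulr_ge0// ball_fun_ge0.
- by move=> y; rewrite mulr_ge0// powR_ge0.
move=> y /eqP yx; rewrite /ball_fun; case: ifP => [h|_]; last first.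
  by rewrite mulr0 mulr_ge0// powR_ge0.
have [mg' dk] := H _ h; rewrite mulr1 ler_pM ?powR_ge0//.
have d0 : 0 < enorm (x - (y : 'rV_n)) by rewrite enorm_gt0 subr_eq0 eq_sym.
have aN : al - N <= 0 by rewrite subr_le0 ltW.
exact: ge_powR2.
Qed.

(** A single unit ball placed where [g] is controlled already yields the decay of the kernel. A
    bound on [g] near infinity suffices, so this applies before [comparable_pow] is established. *)
Lemma riesz_lower_far g w (s C R0 : R) : mfun g -> (forall y, 0 <= g y) ->
  riesz_of al g w -> 0 <= s -> 0 < C ->
  (forall y : 'rV[R]_n, R0 < enorm y -> <|y|> `^ (- s) / C <= g y) ->
  exists2 c : R, 0 < c & forall x : 'rV[R]_n, c * <|x|> `^ (al - N) <= w x.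
Proof.
move=> mg g0 pot s0 C0 far; have alN := al_ltN; have [V V0 HV] := riesz_ge_ball.
have q0 := normr_ge0 R0; have qR := ler_norm R0.
(* Points of the unit ball about [z] have norm between |R0| + 1 and |R0| + 3. Hence their bracket is
   at most [D], and their distance to [x] is at most [D] times the bracket of [x]. *)
have [z hz] := @enorm_exists R n (`|R0| + 2) n_gt0 (ltac:(lra)).
pose D := `|R0| + 4; pose m := D `^ (- s) / C.
have D0 : 0 < D by rewrite /D; lra.
have m0 : 0 < m by apply: divr_gt0 => //; exact: powR_gt0.
exists (V * m * D `^ (al - N)).
  by apply: mulr_gt0; [exact: mulr_gt0|exact: powR_gt0].
move=> x; have x0 := enorm_ge0 x.
rewrite -mulrA -powRM; [|lra..].
have := HV g w z 1 m (D * <|x|>) x mg g0 pot ltr01 (ltW m0).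
rewrite expr1n mulr1; apply => y hy.
have y1 := enormB_le z y; rewrite enormC hz in y1.
have y2 := enormB_le y z; rewrite hz in y2.
split.
  apply: le_trans (far y _); last lra.
  rewrite ler_pM2r ?invr_gt0//; apply: ge_powR2; rewrite /D; lra.
by have := enormD x (- y); rewrite enormN => h; rewrite /D; nra.
Qed.

(** Outside a ball the asymptotic hypothesis applies. Inside, the bracket stays between 1 and [D],
    and [f] is bounded above by [M] and below through the potential estimate; [c1] and [c2] are the
    constants for that region. *)
Lemma comparable_pow_of_asymp f (th c M : R) : 0 < c ->
  (forall x : 'rV[R]_n, c * <|x|> `^ (al - N) <= f x) -> (forall x, f x <= M) -> 0 < th ->
  asymp_equiv f (fun x => <|x|> `^ (- th)) -> comparable_pow f th.
Proof.
move=> c0 lo up th0 [C [C0 [R0 HC]]]; have alN := al_ltN.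
pose D := 1 + `|R0|; have q0 := normr_ge0 R0; have qR := ler_norm R0.
have D1 : 1 <= D by rewrite /D; lra.
have D0 : 0 < D by lra.
pose c1 := (c * D `^ (al - N))^-1; pose c2 := M * D `^ th.
have c10 : 0 < c1 by rewrite invr_gt0 mulr_gt0 ?powR_gt0.
exists (Num.max C (Num.max c1 c2)); first by rewrite lt_max C0.
move=> x; have x0 := enorm_ge0 x; have B0 := bracket_gt0 x.
have P0 : 0 < <|x|> `^ (- th) by rewrite powR_gt0.
have inv_le (X Y : R) : 0 < X -> X <= Y -> <|x|> `^ (- th) / Y <= <|x|> `^ (- th) / X.
  move=> X0 XY; rewrite ler_pM2l// lef_pV2 ?posrE//.
  exact: lt_le_trans XY.
have [h|h] := ltP R0 (enorm x).
  have [h1 h2] := HC x h; split.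
    by apply: le_trans h1; apply: inv_le => //; rewrite le_max lexx.
  by apply: (le_trans h2); rewrite ler_pM2r// le_max lexx.
have xD : <|x|> <= D by rewrite /D; lra.
split.
  apply: (@le_trans _ _ (<|x|> `^ (- th) / c1)).
    by apply: inv_le => //; rewrite !le_max lexx orbT.
  apply: le_trans (lo x); rewrite /c1 invrK.
  apply: (@le_trans _ _ (1 * (c * D `^ (al - N)))).
    have : <|x|> `^ (- th) <= <|x|> `^ 0 by apply: ler_powR; lra.
    by rewrite powRr0; apply: ler_wpM2r; rewrite mulr_ge0 ?powR_ge0// ltW.
  by rewrite mul1r ler_pM2l//; apply: ge_powR2; lra.
apply: (le_trans (up x)).
have M0 : 0 <= M.
  by apply: le_trans (up x); apply: le_trans (lo x); rewrite mulr_ge0 ?powR_ge0 ?(ltW c0).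
apply: (@le_trans _ _ (c2 * <|x|> `^ (- th))); last first.
  by rewrite ler_pM2r// !le_max lexx !orbT.
rewrite /c2 -mulrA ler_peMr// powRN -ler_pdivrMr ?invr_gt0 ?powR_gt0// div1r invrK.
by apply: le_powR2; lra.
Qed.

Lemma comparable_pow_gt0 f th x : comparable_pow f th -> 0 < f x.
Proof.
move=> [C C0 /(_ x) [h _]]; apply: lt_le_trans h.
by rewrite divr_gt0 ?powR_gt0 ?bracket_gt0.
Qed.

Lemma comparable_powR f th q : 0 < q -> comparable_pow f th ->
  comparable_pow (fun x => f x `^ q) (q * th).
Proof.
move=> q0 cf; have [C C0 HC] := cf; exists (C `^ q); first exact: powR_gt0.
move=> x; have [h1 h2] := HC x; have f0 := comparable_pow_gt0 x cf.
have B0 := bracket_gt0 x.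
have E : <|x|> `^ (- (q * th)) = (<|x|> `^ (- th)) `^ q.
  by rewrite -powRrM mulNr mulrC.
split; rewrite E.
  have -> : (C `^ q)^-1 = C^-1 `^ q by rewrite powRV ?(ltW C0)// powRN.
  rewrite -powRM ?powR_ge0 ?invr_ge0 ?(ltW C0)//.
  by apply: le_powR2; [exact: ltW|rewrite divr_ge0 ?powR_ge0 ?(ltW C0)|].
rewrite -powRM ?powR_ge0 ?(ltW C0)//.
by apply: le_powR2 => //; exact: ltW.
Qed.

End exponents.

Section exponent_identity.
Context (R : realType) (n : nat) (n_gt0 : (0 < n)%N).
Implicit Types f g w : Rn R n -> R.

Local Notation J f := (\int[leb R n]_x (f x)%:E)%E.
Local Notation mfun f := (measurable_fun [set: Rn R n] f).
Local Notation N := (n%:R).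
Local Notation "<| x |>" := (1 + enorm x).

Lemma bracket_exists (r : R) : 2 <= r ->
  exists2 x : 'rV[R]_n, <|x|> = r & 1 <= enorm x.
Proof.
move=> r2; have [x hx] := @enorm_exists R n (r - 1) n_gt0 (ltac:(lra)).
by exists x; rewrite hx; lra.
Qed.

(** With r = 1 + |x|, the mass of [g] in the ball of radius r/4 about [x] alone contributes a
    multiple of r^n r^(-s) r^(al - n) to [w x]. *)
Lemma riesz_exponent_le_local (al : R) g w s th : al < N -> mfun g ->
  comparable_pow g s -> comparable_pow w th -> riesz_of al g w -> 0 < s ->
  th <= s - al.
Proof.
move=> alN mg cg cw pot s0.
have g0 y : 0 <= g y by apply: ltW; exact: (comparable_pow_gt0 _ cg).
have [Cg Cg0 HCg] := cg; have [Cw Cw0 HCw] := cw.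
have [V V0 HV] := riesz_ge_ball n_gt0 alN.
pose K := V * (4^-1) ^+ n * (2 `^ (- s) / Cg).
have K0 : 0 < K.
  by rewrite /K; apply: mulr_gt0; [apply: mulr_gt0 => //; apply: exprn_gt0; rewrite invr_gt0
    |apply: divr_gt0 => //; exact: powR_gt0].
suff : al - s <= - th by lra.
apply: (@exponent_le R _ _ (Cw / K)) => r r2.
have [x xr x1] := bracket_exists r2; have r0 : 0 < r by lra.
have m0 : 0 <= (2 * r) `^ (- s) / Cg by rewrite divr_ge0 ?powR_ge0 ?ltW.
have rx : 0 < r / 4 by lra.
have := HV g w x (r / 4) _ r x mg g0 pot rx m0.
have hyp (y : 'rV[R]_n) : enorm (y - x) <= r / 4 ->
    (2 * r) `^ (- s) / Cg <= g y /\ enorm (x - y) <= r.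
  move=> hy; have y1 := enormB_le y x; have y0 := enorm_ge0 y; split.
    have [h _] := HCg y; apply: le_trans h.
    by rewrite ler_pM2r ?invr_gt0//; apply: ge_powR2; lra.
  by rewrite enormC; lra.
move=> /(_ hyp) hw; have [_ hC] := HCw x; rewrite xr in hC.
have {hw hC} := le_trans hw hC.
have -> : V * (r / 4) ^+ n * ((2 * r) `^ (- s) / Cg) * r `^ (al - N) = K * r `^ (al - s).
  rewrite exprMn -(powR_mulrn n (ltW r0)) powRM ?(ltW r0)//.
  have -> : al - s = N + - s + (al - N) by ring.
  have rn0 : r != 0 by rewrite gt_eqF.
  by rewrite !(powR_split _ _ rn0) /K; ring.
by move=> h; rewrite mulrAC ler_pdivlMr// mulrC.
Qed.

Lemma riesz_exponent_le_far (al : R) g w s th : al < N -> mfun g ->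
  comparable_pow g s -> comparable_pow w th -> riesz_of al g w -> 0 < s ->
  th <= N - al.
Proof.
move=> alN mg cg cw pot s0.
have g0 y : 0 <= g y by apply: ltW; exact: (comparable_pow_gt0 _ cg).
have [Cg Cg0 HCg] := cg; have [Cw Cw0 HCw] := cw.
have [|c c0 Hc] := @riesz_lower_far R n n_gt0 al alN g w s Cg 0 mg g0 pot (ltW s0) Cg0.
  by move=> y _; have [] := HCg y.
suff : al - N <= - th by lra.
apply: (@exponent_le R _ _ (Cw / c)) => r r2.
have [x xr x1] := bracket_exists r2.
have [_ hC] := HCw x; have := le_trans (Hc x) hC; rewrite xr => h.
by rewrite mulrAC ler_pdivlMr// mulrC.
Qed.

(** The auxiliary exponent [s'] stays below n where [riesz_upper] applies, even when [g] itself
    decays with s >= n. *)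
Lemma riesz_exponent_ge (al : R) g w s th s' : 0 < al -> al < s' -> s' < N -> s' <= s ->
  mfun g -> comparable_pow g s -> comparable_pow w th -> riesz_of al g w ->
  s' - al <= th.
Proof.
move=> al0 als sN ss mg cg cw pot.
have g0 y : 0 <= g y by apply: ltW; exact: (comparable_pow_gt0 _ cg).
have [Cg Cg0 HCg] := cg; have [Cw Cw0 HCw] := cw.
have [C C0 HC] := riesz_upper n_gt0 al0 als sN.
suff : - th <= al - s' by lra.
apply: (@exponent_le R _ _ (Cw * (Cg * C * 2 `^ `|al - s'|))) => r r2.
have [x xr x1] := bracket_exists r2.
have x0 : x != 0 by rewrite -enorm_gt0; lra.
have up : w x <= Cg * (C * enorm x `^ (al - s')).
  rewrite -lee_fin (pot x) EFinM; have cg0 := ltW Cg0.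
  have mk := @measurable_riesz_integrand R n al (fun y => (1 + enorm y) `^ (- s')) x
    (@measurable_one_enorm R n (- s')).
  apply: (@le_trans _ _ (Cg%:E * J (fun y => (1 + enorm y) `^ (- s') *
     enorm (x - (y : 'rV_n)) `^ (al - N))%R)%E); last first.
    by apply: lee_wpmul2l; [rewrite lee_fin|exact: HC].
  rewrite -(JZ mk _ cg0); last by move=> y; rewrite mulr_ge0 ?powR_ge0.
  apply: (le_J n_gt0 (a := 0 : 'rV_n)).
  - exact: measurable_riesz_integrand.
  - by apply: measurable_funM; [exact: measurable_cst|exact: mk].
  - by move=> y; rewrite mulr_ge0 ?powR_ge0.
  - by move=> y; rewrite !mulr_ge0 ?powR_ge0.
  move=> y _; rewrite mulrA ler_wpM2r ?powR_ge0//.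
  have [_ h] := HCg y; apply: (le_trans h); rewrite ler_pM2l//.
  by apply: ler_powR; have := enorm_ge0 y; lra.
have [lo _] := HCw x; rewrite xr in lo.
have := le_trans lo up; rewrite ler_pdivrMr// => h; apply: (le_trans h).
have e : enorm x `^ (al - s') <= 2 `^ `|al - s'| * r `^ (al - s').
  by apply: le_powR_double; lra.
rewrite [leLHS](_ : _ = (Cw * Cg * C) * enorm x `^ (al - s')); last by ring.
rewrite [leRHS](_ : _ = (Cw * Cg * C) * (2 `^ `|al - s'| * r `^ (al - s'))); last by ring.
by rewrite ler_wpM2l// !mulr_ge0// ltW.
Qed.

(** At the exponent n the function 2^(-n) f(y / 2) has the same integral as f. But f also dominates
    that dilate plus a multiple of the indicator of a ball inside the shell 1 < |y| < 2, where the
    dilate vanishes; a finite integral would be larger than itself. *)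
Lemma outer_pow_critical_divergent : (J (@outer_pow R n N) = +oo)%E.
Proof.
have m0 : mfun (outer_pow N) := measurable_outer_pow N.
have p0 : forall x : Rn R n, 0 <= outer_pow N x := outer_pow_ge0 N.
case E : (J (@outer_pow R n N)) => [T| |] //; last first.
  by have := J_ge0 p0; rewrite E.
exfalso; have [V V0 HV] := ball_volume R n_gt0.
have [z hz] := @enorm_exists R n (3 / 2) n_gt0 (ltac:(lra)).
have q0 : 0 < (4^-1 : R) by rewrite invr_gt0.
have h0 : 0 < (2^-1 : R) by rewrite invr_gt0.
have c0 : 0 <= 2 `^ (- N) :> R := powR_ge0 _ _.
have mb := measurable_ball_fun z (4^-1 : R).
have pb := @ball_fun_ge0 R n z (4^-1).
have ms := measurable_scale_comp (2^-1) m0.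
have T0 : J (fun y => 2 `^ (- N) * outer_pow N (2^-1 *: (y : 'rV_n)))%R = T%:E.
  rewrite (JZ ms (fun y => p0 _) c0) (J_scale m0 p0 h0) E -!EFinM; congr EFin.
  rewrite invrK mulrA -powR_mulrn// -powR_split ?gt_eqF//.
  by rewrite addNr powRr0 mul1r.
have : (J (fun y => 2 `^ (- N) * outer_pow N (2^-1 *: (y : 'rV_n)) +
    2 `^ (- N) * ball_fun z 4^-1 y)%R <= J (@outer_pow R n N))%E.
  apply: (le_J n_gt0 (a := 0 : 'rV_n)) => //.
  - by apply: measurable_funD; apply: measurable_funM.
  - by move=> y; rewrite addr_ge0// mulr_ge0.
  move=> y _; rewrite /outer_pow /ball_fun enormZ gtr0_norm//.
  have tri := enormB_le z y; have tri' := enormB_le y z; rewrite enormC in tri.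
  have [h2|h2] := leP (2^-1 * enorm y) 1.
    rewrite mulr0 add0r; case: ifP => [h|_]; last first.
      by rewrite mulr0; case: ifP => // _; exact: powR_ge0.
    rewrite mulr1 ifF; last by apply/negbTE; rewrite -ltNge; lra.
    by apply: ge_powR2; [rewrite oppr_le0|lra|lra].
  rewrite (_ : (enorm ((y : 'rV_n) - z) <= 4^-1) = false); last first.
    by apply/negbTE; rewrite -ltNge; lra.
  rewrite mulr0 addr0 ifF; last by apply/negbTE; rewrite -ltNge; lra.
  rewrite powRM ?enorm_ge0// powRV// opprK mulrA -powR_split ?gt_eqF//.
  by rewrite addNr powRr0 mul1r.
rewrite JD; last 4 first.
- by apply: measurable_funM.
- by apply: measurable_funM.
- by move=> y; rewrite mulr_ge0.
- by move=> y; rewrite mulr_ge0.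
rewrite T0 E (JZ mb pb c0) (HV z _ q0) -EFinM -EFinD lee_fin.
have : 0 < 2 `^ (- N) * (V * 4^-1 ^+ n).
  by apply: mulr_gt0; [exact: powR_gt0|apply: mulr_gt0 => //; exact: exprn_gt0].
by lra.
Qed.

(** A point at distance m + 1 sees all the mass of [g] in the ball of that radius through a kernel
    of at least (2 (m + 1))^(al - n). The assumed decay of [w] therefore bounds this mass uniformly
    in m, whereas a function comparable to |y|^(-n) has infinite mass. *)
Lemma riesz_critical_exponent_false (al : R) g w : al < N ->
  mfun g -> comparable_pow g N -> comparable_pow w (N - al) -> riesz_of al g w -> False.
Proof.
move=> alN mg cg cw pot.
have g0 y : 0 <= g y by apply: ltW; exact: (comparable_pow_gt0 _ cg).
have [Cg Cg0 HCg] := cg; have [Cw Cw0 HCw] := cw.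
pose f m (y : Rn R n) := if enorm y <= m.+1%:R then g y else 0.
have mf m : mfun (f m).
  apply: measurable_fun_ifT => //; apply: measurable_fun_ler => //.
  exact: measurable_enorm.
have f0 m y : 0 <= f m y by rewrite /f; case: ifP.
pose S := Cw * 2 `^ (N - al).
have fS m : (J (f m) <= S%:E)%E.
  have m0 : 0 < m.+1%:R :> R by rewrite ltr0n.
  have [x hx] := @enorm_exists R n m.+1%:R n_gt0 (ltW m0).
  pose c : R := (2 * m.+1%:R) `^ (al - N).
  have c0 : 0 < c by apply: powR_gt0; rewrite mulr_gt0.
  rewrite -(@lee_pmul2l _ c%:E)//.
  rewrite -(JZ (mf m) (f0 m) (ltW c0)).
  apply: (@le_trans _ _ (w x)%:E).
    rewrite (pot x); apply: (le_J n_gt0 (a := x)).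
    - by apply: measurable_funM; [exact: measurable_cst|exact: mf].
    - exact: measurable_riesz_integrand.
    - by move=> y; rewrite mulr_ge0// ltW.
    - by move=> y; rewrite mulr_ge0// powR_ge0.
    move=> y /eqP yx; rewrite /f; case: ifP => [hy|_]; last first.
      by rewrite mulr0 mulr_ge0// powR_ge0.
    rewrite mulrC ler_wpM2l//.
    have d0 : 0 < enorm (x - (y : 'rV_n)) by rewrite enorm_gt0 subr_eq0 eq_sym.
    have aN : al - N <= 0 by rewrite subr_le0 ltW.
    apply: ge_powR2 => //; have := enormD x (- (y : 'rV_n)); rewrite enormN hx.
    by move: hy; lra.
  have [_ h] := HCw x; rewrite -EFinM lee_fin; apply: (le_trans h).
  have -> : c * S = Cw * (2 `^ (al - N) * 2 `^ (N - al) * m.+1%:R `^ (al - N)).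
    by rewrite /S /c powRM ?(ltW m0)//; ring.
  rewrite opprB -powR_split ?gt_eqF// (_ : al - N + (N - al) = 0); last by ring.
  rewrite powRr0 mul1r hx ler_pM2l//.
  by apply: ge_powR2; [rewrite subr_le0 ltW|by []|lra].
(* With [rho = 0], [J_absorb] is plain monotone convergence. *)
have Jg : (J g <= (S / (1 - 0))%:E)%E.
  apply: (J_absorb mf) => //.
  - move=> x m k mk; rewrite /f; case: ifP => [h|_]; last exact: f0.
    by rewrite ifT// (le_trans h)// ler_nat.
  - move=> x; exists (Num.truncn (enorm x)) => k hk; rewrite /f ifT//.
    apply: ltW; apply: lt_le_trans (_ : (Num.truncn (enorm x)).+1%:R <= _).
      exact: truncnS_gt.
    by rewrite ler_nat.
  - by move=> m; apply: le_lt_trans (fS m) _; exact: ltry.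
  - by move=> m; rewrite mul0e add0e; exact: fS.
have := outer_pow_critical_divergent.
have c0 : 0 <= 2 `^ N * Cg by rewrite mulr_ge0 ?powR_ge0// ltW.
have : (J (@outer_pow R n N) <= (2 `^ N * Cg)%:E * J g)%E.
  rewrite -(JZ mg g0 c0); apply: (le_J n_gt0 (a := 0 : 'rV_n)).
  - exact: measurable_outer_pow.
  - by apply: measurable_funM; [exact: measurable_cst|exact: mg].
  - exact: outer_pow_ge0.
  - by move=> y; rewrite mulr_ge0.
  move=> y _; have [h _] := HCg y; rewrite -mulrA.
  have : <|y|> `^ (- N) <= Cg * g y by rewrite mulrC -ler_pdivrMr.
  move=> h'; apply: (@le_trans _ _ (2 `^ N * <|y|> `^ (- N))); last first.
    by rewrite ler_wpM2l ?powR_ge0.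
  rewrite /outer_pow; have [h1|h1] := leP (enorm y) 1.
    by rewrite mulr_ge0 ?powR_ge0.
  have := @le_powR_double R (- N) (enorm y) <|y|>; rewrite normrN ger0_norm//.
  by apply; lra.
move=> + E; rewrite E leye_eq => /eqP h.
have : ((2 `^ N * Cg)%:E * J g <= (2 `^ N * Cg * (S / (1 - 0)))%:E)%E.
  by rewrite [leRHS]EFinM; apply: lee_wpmul2l; rewrite ?lee_fin.
by rewrite h.
Qed.

Lemma riesz_exponent (al : R) g w s th : 0 < al -> al < N -> 0 < s -> 0 < th ->
  mfun g -> comparable_pow g s -> comparable_pow w th -> riesz_of al g w ->
  [/\ th <= s - al, s < N -> th = s - al, N <= s -> th = N - al & s <> N].
Proof.
move=> al0 alN s0 th0 mg cg cw pot.
have le1 := riesz_exponent_le_local alN mg cg cw pot s0.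
have le2 := riesz_exponent_le_far alN mg cg cw pot s0.
have big : N <= s -> th = N - al.
  move=> Ns; apply/eqP; rewrite eq_le le2/= leNgt; apply/negP => lt.
  (* The midpoint of th + al and n is an admissible exponent, and it would force [th] above its own
     value. *)
  have := @riesz_exponent_ge al g w s th ((th + al + N) / 2) al0.
  move=> /(_ _ _ _ mg cg cw pot) h.
  have : (th + al + N) / 2 - al <= th by apply: h; lra.
  by lra.
split => // [sN|sN].
  apply/eqP; rewrite eq_le le1/=.
  by apply: (riesz_exponent_ge al0 _ sN (lexx s) mg cg cw pot); lra.
rewrite sN in cg big; rewrite (big (lexx _)) in cw.
exact: (riesz_critical_exponent_false alN mg cg cw pot).
Qed.

End exponent_identity.

(** * Lipschitz bound under dilations *)

Section dilation.
Context (R : realType) (n : nat) (n_gt0 : (0 < n)%N).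
Implicit Types f g w : Rn R n -> R.

Local Notation J f := (\int[leb R n]_x (f x)%:E)%E.
Local Notation mfun f := (measurable_fun [set: Rn R n] f).
Local Notation N := (n%:R).

Definition doubling g (D : R) := forall x y : 'rV[R]_n,
  enorm (y - x) <= enorm x / 2 -> g y <= D * g x /\ g x <= D * g y.

(* The kernel is cut at height (eps |x|)^(al - N) rather than restricted to
   |x - y| > eps |x|, so that the far part depends smoothly on x. *)
Definition far_kernel (al rho r : R) := Num.min (r `^ (al - N)) (rho `^ (al - N)).

Definition near_kernel (al rho r : R) := r `^ (al - N) - far_kernel al rho r.

Lemma far_kernel_ge0 al rho r : 0 <= far_kernel al rho r.
Proof. by rewrite /far_kernel le_min !powR_ge0. Qed.

Lemma near_kernel_ge0 al rho r : 0 <= near_kernel al rho r.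
Proof. by rewrite subr_ge0 ge_min lexx. Qed.

Lemma measurable_far_kernel al rho (x : 'rV[R]_n) :
  mfun (fun y => far_kernel al rho (enorm (x - (y : 'rV_n)))).
Proof. by apply: measurable_minr; [exact: measurable_dist_powR|exact: measurable_cst]. Qed.

Lemma measurable_near_kernel al rho (x : 'rV[R]_n) :
  mfun (fun y => near_kernel al rho (enorm (x - (y : 'rV_n)))).
Proof.
by apply: measurable_funB; [exact: measurable_dist_powR|exact: measurable_far_kernel].
Qed.

(** Scaling the threshold together with the distance makes the near part transform exactly under
    dilation. *)
Lemma near_kernelZ al rho r c : 0 < c -> 0 <= rho -> 0 <= r ->
  near_kernel al (c * rho) (c * r) = c `^ (al - N) * near_kernel al rho r.
Proof.
move=> c0 rho0 r0; rewrite /near_kernel /far_kernel !powRM ?(ltW c0)//.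
by rewrite mulrBr minr_pMr ?powR_ge0.
Qed.

(** For positive r the far kernel is max(r, rho)^(al - n), so it suffices to compare the two maxima;
    [1 <= c * H] handles the threshold [rho]. *)
Lemma far_kernel_le (al rho r r' c H : R) : al < N -> 0 < c -> 0 < rho -> 0 < r -> 0 <= r' ->
  1 <= c * H -> r <= H * Num.max r' (c * rho) ->
  far_kernel al (c * rho) r' <= H `^ (N - al) * far_kernel al rho r.
Proof.
move=> alN c0 rho0 r0 r'0 cH rH.
have H0 : 0 < H by rewrite -(pmulr_rgt0 _ c0); lra.
(* At [r' = 0] the power takes its default value 0, so the far kernel vanishes there instead of
   staying on its plateau. *)
have [->|r'n0] := eqVneq r' 0.
  rewrite /far_kernel powR0; last by rewrite subr_eq0 lt_eqF.
  by rewrite minEle powR_ge0 mulr_ge0 ?powR_ge0 ?far_kernel_ge0.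
have r'0' : 0 < r' by rewrite lt_def r'n0.
set M := Num.max r' (c * rho) in rH.
have crho0 : 0 < c * rho by rewrite mulr_gt0.
have M0 : 0 < M by rewrite lt_max r'0'.
have aN : al - N <= 0 by rewrite subr_le0 ltW.
have e : far_kernel al (c * rho) r' <= M `^ (al - N).
  by rewrite /far_kernel /M; have [_|_] := leP r' (c * rho); rewrite ge_min lexx ?orbT.
apply: (le_trans e).
have key X : 0 < X -> X <= H * M -> M `^ (al - N) <= H `^ (N - al) * X `^ (al - N).
  move=> X0 XM; apply: (@le_trans _ _ (H `^ (N - al) * (H * M) `^ (al - N))).
    rewrite powRM ?(ltW H0) ?(ltW M0)// mulrA -powR_split ?gt_eqF//.
    by rewrite (_ : N - al + (al - N) = 0) ?powRr0 ?mul1r//; ring.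
  by rewrite ler_wpM2l ?powR_ge0//; exact: ge_powR2.
rewrite /far_kernel minr_pMr ?powR_ge0// le_min !key//.
apply: (@le_trans _ _ (H * (c * rho))); last by rewrite ler_pM2l// le_max lexx orbT.
by rewrite mulrA (mulrC H) ler_peMl// ltW.
Qed.

Lemma J_unscale c f : mfun f -> (forall x, 0 <= f x) -> 0 < c ->
  (J f = (c ^+ n)%:E * J (fun y => f (c *: (y : 'rV_n))%R))%E.
Proof.
move=> mf f0 c0; have cc : c ^+ n * c^-1 ^+ n = 1.
  by rewrite exprVn mulfV// expf_neq0// gt_eqF.
by rewrite (J_scale mf f0 c0) muleA -EFinM cc mul1e.
Qed.

(** Near x replace g(y) by D g(x). Scaling turns the kernel integral over radius eps |x| into (2
    eps)^al times the one over radius |x| / 2, and on that larger ball D g(y) bounds g(x) in turn,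
    which brings back the potential. Hence the factor D^2 (2 eps)^al, small with eps. *)
Lemma near_part_le (al eps D : R) g w (x : 'rV[R]_n) : al < N -> 0 < eps -> eps <= 1 / 2 ->
  mfun g -> (forall y, 0 <= g y) -> riesz_of al g w -> 0 <= D -> doubling g D -> x != 0 ->
  (J (fun y => g y * near_kernel al (eps * enorm x) (enorm (x - (y : 'rV_n))))
   <= (D ^+ 2 * (2 * eps) `^ al * w x)%:E)%E.
Proof.
move=> alN e0 e1 mg g0 pot D0 dbl x0.
have r0 : 0 < enorm x by rewrite enorm_gt0.
have aN : al - N <= 0 by rewrite subr_le0 ltW.
pose h (d : R) (z : Rn R n) := if enorm z <= d * enorm x then enorm z `^ (al - N) else 0.
have h0 d z : 0 <= h d z by rewrite /h; case: ifP => // _; exact: powR_ge0.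
have mh d : mfun (h d).
  apply: measurable_fun_ifT.
  - by apply: measurable_fun_ler; [exact: measurable_enorm|exact: measurable_cst].
  - by apply: measurable_powR_comp; exact: measurable_enorm.
  - exact: measurable_cst.
have mhx d : mfun (fun y => h d ((y : 'rV_n) - x)).
  have := measurable_affine_comp 1 (- x) (mh d).
  by apply: eq_measurable_fun => y _; rewrite scale1r.
have gx0 : 0 <= D * g x by rewrite mulr_ge0.
have t0 : 0 < 2 * eps by lra.
have ti0 : 0 < (2 * eps)^-1 by rewrite invr_gt0.
have scal : J (h eps) = (((2 * eps) `^ al)%:E * J (h 2^-1))%E.
  transitivity (J (fun z => (2 * eps) `^ (al - N) * h 2^-1 ((2 * eps)^-1 *: (z : 'rV_n)))%R).
    apply: eq_integral => z _; congr EFin; rewrite /h enormZ gtr0_norm//.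
    rewrite ler_pdivrMl// (_ : 2 * eps * (2^-1 * enorm x) = eps * enorm x); last by field.
    case: ifP => _; last by rewrite mulr0.
    rewrite (powRM _ (ltW ti0) (enorm_ge0 z)) (powRV _ (ltW t0)) mulrA -powR_split ?gt_eqF//.
    by rewrite subrr powRr0 mul1r.
  rewrite (JZ (measurable_scale_comp _ (mh _)) (fun z => h0 _ _) (powR_ge0 _ _)).
  rewrite (J_scale (mh _) (h0 _) ti0) muleA -EFinM invrK.
  rewrite -(powR_mulrn _ (ltW t0)) -powR_split ?gt_eqF//.
  by rewrite subrK.
apply: (@le_trans _ _ (J (fun y => D * g x * h eps ((y : 'rV_n) - x))%R)).
  apply: (le_J n_gt0 (a := x)).
  - by apply: measurable_funM; [exact: mg|exact: measurable_near_kernel].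
  - by apply: measurable_funM; [exact: measurable_cst|exact: mhx].
  - by move=> y; rewrite mulr_ge0// near_kernel_ge0.
  - by move=> y; rewrite mulr_ge0.
  move=> y /eqP yx; rewrite /h -(enormC x).
  have d0 : 0 < enorm (x - (y : 'rV_n)) by rewrite enorm_gt0 subr_eq0 eq_sym.
  have [hy|hy] := leP (enorm (x - (y : 'rV_n))) (eps * enorm x).
    apply: ler_pM => //; first exact: near_kernel_ge0.
      have [] // := dbl x y; rewrite -(enormC x); apply: (le_trans hy).
      by rewrite mulrC ler_pM2l//; lra.
    by rewrite /near_kernel gerDl oppr_le0 far_kernel_ge0.
  rewrite mulr0 /near_kernel /far_kernel (min_idPl _) ?subrr ?mulr0//.
  by apply: ge_powR2 => //; [rewrite mulr_gt0|exact: ltW].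
rewrite (JZ (mhx _) (fun y => h0 _ _) gx0) (J_shift x (mh _) (h0 _)) scal.
rewrite -(J_shift x (mh _) (h0 _)).
rewrite (_ : D ^+ 2 * (2 * eps) `^ al * w x = D * (2 * eps) `^ al * (D * w x)); last by ring.
have Dt0 : 0 <= D * (2 * eps) `^ al by rewrite mulr_ge0 ?powR_ge0.
rewrite muleA -EFinM (_ : D * g x * (2 * eps) `^ al = D * (2 * eps) `^ al * g x); last by ring.
rewrite [in leLHS]EFinM -muleA [leRHS]EFinM; apply: lee_wpmul2l; first by rewrite lee_fin.
have mk := measurable_riesz_integrand al x mg.
have k0 y : 0 <= g y * enorm (x - (y : 'rV_n)) `^ (al - N) by rewrite mulr_ge0 ?powR_ge0.
rewrite -(JZ (mhx _) (fun y => h0 _ _) (g0 x)) EFinM (pot x) -(JZ mk k0 D0).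
apply: (le_J n_gt0 (a := x)).
- by apply: measurable_funM; [exact: measurable_cst|exact: mhx].
- by apply: measurable_funM; [exact: measurable_cst|exact: mk].
- by move=> y; rewrite mulr_ge0.
- by move=> y; rewrite mulr_ge0.
move=> y /eqP yx; rewrite /h -(enormC x).
case: ifP => [hy|_]; last by rewrite mulr0 mulr_ge0.
rewrite mulrA ler_wpM2r ?powR_ge0//.
by have [] // := dbl x y; rewrite -(enormC x); apply: (le_trans hy); lra.
Qed.

(** Only the near part sees the modulus [G] of [g]. If a and b are the far and near parts of w(x),
    those of w(c x) are at most Q a and Q G b, and Q (a + G b) = Q (w(x) + (G - 1) b) with b a small
    multiple of w(x). *)
Lemma dilation_step (al eps D H c Q G : R) g w : al < N ->
  0 < eps -> eps <= 1 / 2 -> mfun g -> (forall y, 0 <= g y) -> riesz_of al g w ->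
  0 <= D -> doubling g D -> 0 < c -> 1 + `|1 - c^-1| / eps <= H ->
  H `^ (N - al) <= Q -> c `^ al <= Q -> 1 <= G ->
  (forall y : 'rV[R]_n, g (c *: y) <= G * g y) ->
  forall x : 'rV[R]_n, x != 0 ->
  w (c *: x) <= Q * (1 + D ^+ 2 * (2 * eps) `^ al * (G - 1)) * w x.
Proof.
move=> alN e0 e1 mg g0 pot D0 dbl c0 hH HQ cQ G1 gG x x0.
have r0 : 0 < enorm x by rewrite enorm_gt0.
have Q0 : 0 <= Q by apply: le_trans HQ; exact: powR_ge0.
have G0 : 0 <= G by lra.
pose rho := eps * enorm x; have rho0 : 0 < rho by rewrite mulr_gt0.
pose F y := g y * far_kernel al rho (enorm (x - (y : 'rV_n))).
pose K y := g y * near_kernel al rho (enorm (x - (y : 'rV_n))).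
pose F' y := g y * far_kernel al (c * rho) (enorm (c *: x - (y : 'rV_n))).
pose K' y := g y * near_kernel al (c * rho) (enorm (c *: x - (y : 'rV_n))).
have F0 y : 0 <= F y by rewrite mulr_ge0 ?far_kernel_ge0.
have K0 y : 0 <= K y by rewrite mulr_ge0 ?near_kernel_ge0.
have F'0 y : 0 <= F' y by rewrite mulr_ge0 ?far_kernel_ge0.
have K'0 y : 0 <= K' y by rewrite mulr_ge0 ?near_kernel_ge0.
have mF : mfun F by apply: measurable_funM; [exact: mg|exact: measurable_far_kernel].
have mK : mfun K by apply: measurable_funM; [exact: mg|exact: measurable_near_kernel].
have mF' : mfun F' by apply: measurable_funM; [exact: mg|exact: measurable_far_kernel].
have mK' : mfun K' by apply: measurable_funM; [exact: mg|exact: measurable_near_kernel].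
have wE : ((w x)%:E = J F + J K)%E.
  rewrite (pot x) -(JD mF mK F0 K0); apply: eq_integral => y _; congr EFin.
  by rewrite /F /K /near_kernel; ring.
have w'E : ((w (c *: x))%:E = J F' + J K')%E.
  rewrite (pot (c *: x)) -(JD mF' mK' F'0 K'0); apply: eq_integral => y _; congr EFin.
  by rewrite /F' /K' /near_kernel; ring.
(* Here [y] is kept fixed and only the kernel moves: |x - y| <= |c x - y| + |1 - c| |x|, and the
   last term is |1 - 1/c| / eps times the threshold c rho. *)
have FF : (J F' <= Q%:E * J F)%E.
  rewrite -(JZ mF F0 Q0); apply: (le_J n_gt0 (a := x)) => //.
    by apply: measurable_funM; [exact: measurable_cst|exact: mF].
    by move=> y; rewrite mulr_ge0.
  move=> y /eqP yx; rewrite /F' /F [leRHS]mulrCA ler_wpM2l//.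
  have d0 : 0 < enorm (x - (y : 'rV_n)) by rewrite enorm_gt0 subr_eq0 eq_sym.
  have a0 := normr_ge0 (1 - c^-1).
  have ae0 : 0 <= `|1 - c^-1| / eps by rewrite divr_ge0// ltW.
  have cne : c != 0 by rewrite gt_eqF.
  apply: (@le_trans _ _ (H `^ (N - al) * far_kernel al rho (enorm (x - (y : 'rV_n)))));
    last first.
    by rewrite ler_wpM2r ?far_kernel_ge0.
  have e2 : eps <= 1 by lra.
  have Hbig : 1 + `|1 - c^-1| <= H.
    apply: le_trans hH; rewrite lerD2l ler_pdivlMr//.
    by rewrite ler_piMr.
  apply: far_kernel_le => //; first exact: enorm_ge0.
    apply: (@le_trans _ _ (c * (1 + `|1 - c^-1|))); last by rewrite ler_pM2l.
    rewrite -ler_pdivrMl// mulr1; have := ler_norm (c^-1 - 1).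
    by rewrite distrC; lra.
  set M := Num.max _ _.
  have M1 : enorm (c *: x - (y : 'rV_n)) <= M by rewrite le_max lexx.
  have M2 : c * rho <= M by rewrite le_max lexx orbT.
  have M0 : 0 <= M by apply: le_trans M1; exact: enorm_ge0.
  apply: (@le_trans _ _ ((1 + `|1 - c^-1| / eps) * M)); last by rewrite ler_wpM2r.
  have -> : x - (y : 'rV_n) = (c *: x - (y : 'rV_n)) + (1 - c) *: x.
    by apply/rowP => i; rewrite !mxE; ring.
  apply: (le_trans (enormD _ _)); rewrite mulrDl mul1r; apply: lerD => //.
  rewrite enormZ.
  have -> : `|1 - c| * enorm x = `|1 - c^-1| / eps * (c * rho).
    have -> : `|1 - c| = c * `|1 - c^-1|.
      rewrite -{2}(gtr0_norm c0) -normrM mulrBr mulr1 divff//.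
      by rewrite distrC.
    by rewrite /rho; field; rewrite gt_eqF.
  by rewrite ler_wpM2l.
(* Here y is replaced by c y instead, so the kernel scales exactly; the Jacobian c^n and the kernel
   factor c^(al - n) combine to c^al. *)
have KK : (J K' <= (Q * G)%:E * J K)%E.
  have cn0 : 0 < c ^+ n by rewrite exprn_gt0.
  rewrite (J_unscale mK' K'0 c0).
  have QG0 : 0 <= Q * G by rewrite mulr_ge0.
  rewrite -(JZ mK K0 QG0) -(JZ (measurable_scale_comp _ mK') (fun y => K'0 _) (ltW cn0)).
  apply: (le_J n_gt0 (a := x)).
  - by apply: measurable_funM; [exact: measurable_cst|exact: measurable_scale_comp].
  - by apply: measurable_funM; [exact: measurable_cst|exact: mK].
  - by move=> y; rewrite mulr_ge0// ltW.
  - by move=> y; rewrite mulr_ge0.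
  move=> y _; rewrite /K' /K -scalerBr enormZ (gtr0_norm c0).
  rewrite near_kernelZ ?(ltW rho0) ?enorm_ge0//.
  have -> : c ^+ n * (g (c *: (y : 'rV_n)) * (c `^ (al - N) *
      near_kernel al rho (enorm (x - (y : 'rV_n))))) =
    c `^ al * (g (c *: (y : 'rV_n)) * near_kernel al rho (enorm (x - (y : 'rV_n)))).
    have -> : c `^ al = c ^+ n * c `^ (al - N).
      rewrite -(powR_mulrn n (ltW c0)) -powR_split ?gt_eqF//.
      by congr (_ `^ _); ring.
    by ring.
  rewrite -[leRHS]mulrA; apply: ler_pM => //.
  - by rewrite powR_ge0.
  - by rewrite mulr_ge0// near_kernel_ge0.
  - by rewrite mulrA ler_wpM2r ?near_kernel_ge0.
have := near_part_le alN e0 e1 mg g0 pot D0 dbl x0; rewrite -/rho -/K.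
have := J_ge0 F0; have := J_ge0 K0; move: wE w'E FF KK.
case: (J F) => [a| |]//; case: (J K) => [b| |]//.
rewrite -EFinD => -[->] w'E FF KK; rewrite !lee_fin => b0 a0 near.
have : ((w (c *: x))%:E <= (Q * a + Q * G * b)%:E)%E.
  by rewrite w'E EFinD; apply: leeD; rewrite EFinM.
rewrite lee_fin => h; apply: (le_trans h).
set d := D ^+ 2 * (2 * eps) `^ al in near *.
rewrite [leLHS](_ : _ = Q * (a + G * b)); last by ring.
rewrite -[leRHS]mulrA; apply: ler_wpM2l => //.
have : (G - 1) * b <= (G - 1) * (d * (a + b)) by apply: ler_wpM2l => //; lra.
by lra.
Qed.

End dilation.

(** * Elementary bounds on the exponential *)

Section expR_facts.
Context (R : realType).

Lemma expR_powR (y r : R) : expR y `^ r = expR (r * y).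
Proof. by rewrite /powR gt_eqF ?expR_gt0// expRK. Qed.

Lemma expR_sub1_le (y : R) : expR y - 1 <= y * expR y.
Proof.
have := expR_ge1Dx (- y); rewrite expRN => h.
have e0 := expR_gt0 y.
have : (1 - y) * expR y <= (expR y)^-1 * expR y by rewrite ler_pM2r.
by rewrite mulVf ?gt_eqF//; lra.
Qed.

Lemma expR_small (h : R) : 0 < h -> h <= 1 / 4 ->
  `|1 - expR h| <= 2 * h /\ `|1 - expR (- h)| <= 2 * h.
Proof.
move=> h0 h1; have e0 := expR_gt0 h.
have u1 := expR_ge1Dx h; have u2 := expR_ge1Dx (- h).
have u3 : expR h <= 2.
  rewrite leNgt; apply/negP => h2; have := expR_sub1_le h.
  have : 2 * (3 / 4) <= expR h * (1 - h) by apply: ler_pM; lra.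
  by lra.
have u4 := expR_sub1_le h; have u5 : expR (- h) <= 1 by rewrite -expR0 ler_expR; lra.
by split; rewrite ler_norml; apply/andP; split; nra.
Qed.

(** With dilation moduli written as exponentials, a near part of small weight [d] turns the modulus
    [A] of one function into at most [A / 2], provided all moduli stay below a fixed [B]. *)
Lemma contraction_bound (d q A B : R) : 0 <= d -> 0 < q -> 0 <= A -> A <= B ->
  d * q * expR (q * B) <= 1 / 2 -> 1 + d * (expR (q * A) - 1) <= expR (A / 2).
Proof.
move=> d0 q0 A0 AB hd; apply: le_trans (expR_ge1Dx _); rewrite lerD2l.
have e1 : expR (q * A) - 1 <= q * A * expR (q * B).
  apply: (le_trans (expR_sub1_le _)); rewrite ler_wpM2l ?mulr_ge0 ?(ltW q0)//.
  by rewrite ler_expR ler_pM2l.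
apply: (@le_trans _ _ (d * (q * A * expR (q * B)))); first by rewrite ler_wpM2l.
rewrite (_ : d * (q * A * expR (q * B)) = A * (d * q * expR (q * B))); last by ring.
by apply: ler_wpM2l => //; lra.
Qed.

Lemma le_limit_halves (l a b : R) : (forall m, l <= a + b / 2 ^+ m) -> l <= a.
Proof.
move=> h; rewrite leNgt; apply/negP => al.
have b0 : 0 < b by have := h 0%N; rewrite expr0 divr1; lra.
pose m := Num.truncn (b / (l - a)).
have hm : b / (l - a) < 2 ^+ m.
  apply: lt_le_trans (truncnS_gt _) _; rewrite -natrX ler_nat.
  exact: ltn_expl.
have := h m; rewrite -lerBlDl ler_pdivlMr ?exprn_gt0// leNgt => /negP; apply.
by move: hm; rewrite ltr_pdivrMr ?subr_gt0// mulrC.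
Qed.

End expR_facts.

(** * Iterating the dilation estimate *)

Section dilation_lipschitz.
Context (R : realType) (n : nat) (n_gt0 : (0 < n)%N).
Implicit Types f g u v : Rn R n -> R.

Local Notation mfun f := (measurable_fun [set: Rn R n] f).
Local Notation N := (n%:R).
Local Notation "<| x |>" := (1 + enorm x).

(** When |y - x| <= |x| / 2 the brackets of x and y differ by a factor of at most 2. That the
    constant is at least 1 is seen by taking both points at the origin. *)
Lemma comparable_doubling f th : comparable_pow f th -> exists2 D, 1 <= D & doubling f D.
Proof.
move=> cf; have [C C0 HC] := cf.
have P0 : 0 <= C * C * 2 `^ `|- th| by rewrite !mulr_ge0 ?powR_ge0 ?ltW.
have dbl : forall x y : 'rV[R]_n, <|y|> <= 2 * <|x|> -> <|x|> <= 2 * <|y|> ->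
    f y <= (C * C * 2 `^ `|- th|) * f x.
  move=> x y xy yx; have [_ h1] := HC y; have [h2 _] := HC x.
  apply: (le_trans h1); rewrite ler_pdivrMr// in h2.
  rewrite (_ : C * C * 2 `^ `|- th| * f x = C * (2 `^ `|- th| * (f x * C))); last by ring.
  rewrite ler_pM2l//; apply: (@le_trans _ _ (2 `^ `|- th| * <|x|> `^ (- th))).
    by apply: le_powR_double => //; exact: bracket_gt0.
  by rewrite ler_wpM2l ?powR_ge0.
have dblf : doubling f (C * C * 2 `^ `|- th|).
  move=> x y hxy; have x0 := enorm_ge0 x; have y0 := enorm_ge0 y.
  have t1 := enormB_le y x; have t2 := enormB_le x y; rewrite enormC in t2.
  by split; apply: dbl; lra.
exists (C * C * 2 `^ `|- th|) => //.
have [h _] := dblf 0 0 (ltac:(by rewrite subrr enorm0 mul0r)).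
have f0 : 0 < f (0 : 'rV_n) := comparable_pow_gt0 _ cf.
by rewrite -(ler_pM2r f0) mul1r.
Qed.

Lemma doubling_powR f D q : (forall x, 0 <= f x) -> 0 <= D -> 0 <= q ->
  doubling f D -> doubling (fun x => f x `^ q) (D `^ q).
Proof.
move=> f0 D0 q0 dbl x y /dbl[h1 h2].
by split; rewrite -powRM//; apply: le_powR2.
Qed.

Lemma riesz_dilation_lipschitz (al p q D : R) u v : 0 < al -> al < N -> 0 < p -> 0 < q ->
  mfun u -> mfun v -> (forall x, 0 < u x) -> (forall x, 0 < v x) ->
  riesz_of al (fun y => v y `^ q) u -> riesz_of al (fun y => u y `^ p) v ->
  1 <= D -> doubling u D -> doubling v D ->
  exists L h0 : R, [/\ 0 <= L, 0 < h0 & forall h c, 0 < h -> h <= h0 ->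
    c = expR h \/ c = expR (- h) -> forall x : 'rV[R]_n,
    u (c *: x) <= expR (L * h) * u x /\ v (c *: x) <= expR (L * h) * v x].
Proof.
move=> al0 alN p0 q0 mu mv u0 v0 potu potv D1 du dv.
have D0 : 0 < D by lra.
pose A0 := ln D; have A00 : 0 <= A0 by rewrite ln_ge0.
have DE : D = expR A0 by rewrite lnK.
(* An upper bound for all the moduli [A m] below, so that [eps] is fixed before the iteration and
   independently of [h]. *)
pose B := A0 + 1.
pose K := (D `^ q) ^+ 2 * q * expR (q * B) + (D `^ p) ^+ 2 * p * expR (p * B).
have k1 : 0 < (D `^ q) ^+ 2 * q * expR (q * B).
  by rewrite mulr_gt0 ?expR_gt0// mulr_gt0// exprn_gt0// powR_gt0.
have k2 : 0 < (D `^ p) ^+ 2 * p * expR (p * B).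
  by rewrite mulr_gt0 ?expR_gt0// mulr_gt0// exprn_gt0// powR_gt0.
have K0 : 0 < K by rewrite addr_gt0.
(* [t] is 2 eps, chosen so that the hypothesis of [contraction_bound] holds for both equations at
   once. *)
pose t := Num.min 1 ((2 * K)^-1 `^ al^-1).
have t0 : 0 < t by rewrite lt_min ltr01 powR_gt0// invr_gt0 mulr_gt0.
have t1 : t <= 1 by rewrite ge_min lexx.
have tal : K * t `^ al <= 1 / 2.
  have : t `^ al <= ((2 * K)^-1 `^ al^-1) `^ al.
    by apply: le_powR2; [exact: ltW|exact: ltW|rewrite ge_min lexx orbT].
  rewrite -powRrM mulVf ?gt_eqF// powRr1; last by rewrite invr_ge0 mulr_ge0// ltW.
  rewrite -(ler_pM2l K0) => h; apply: (le_trans h).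
  by rewrite invfM mulrCA mulfV ?gt_eqF// mulr1 div1r.
have ta0 : 0 <= t `^ al := powR_ge0 _ _.
pose eps := t / 2; have e0 : 0 < eps by rewrite /eps; lra.
have e1 : eps <= 1 / 2 by rewrite /eps; lra.
have te : 2 * eps = t by rewrite /eps; lra.
have dq : (D `^ q) ^+ 2 * (2 * eps) `^ al * q * expR (q * B) <= 1 / 2.
  rewrite te; apply: le_trans tal.
  rewrite (_ : _ * q * _ = ((D `^ q) ^+ 2 * q * expR (q * B)) * t `^ al); last by ring.
  by rewrite ler_wpM2r// lerDl ltW.
have dp : (D `^ p) ^+ 2 * (2 * eps) `^ al * p * expR (p * B) <= 1 / 2.
  rewrite te; apply: le_trans tal.
  rewrite (_ : _ * p * _ = ((D `^ p) ^+ 2 * p * expR (p * B)) * t `^ al); last by ring.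
  by rewrite ler_wpM2r// lerDr ltW.
(* [al] pays for the factor c^al of the near part, and (n - al) (2 / eps) for the variation of the
   far kernel. *)
pose C := al + (N - al) * (2 / eps).
have c1 : 0 < (N - al) * (2 / eps) by apply: mulr_gt0; [lra|exact: divr_gt0].
have C0 : 0 < C by rewrite /C; lra.
exists (2 * C), (Num.min (1 / 4) (2 * C)^-1); split.
- by rewrite mulr_ge0// ltW.
- rewrite lt_min; apply/andP; split; first by lra.
  by rewrite invr_gt0; apply: mulr_gt0.
move=> h c h0 hh hc.
have h4 : h <= 1 / 4 by apply: le_trans hh _; rewrite ge_min lexx.
have hC : 2 * C * h <= 1.
  have : h <= (2 * C)^-1 by apply: le_trans hh _; rewrite ge_min lexx orbT.
  have CC : 0 < 2 * C by rewrite mulr_gt0.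
  by rewrite -(ler_pM2l CC) mulfV// gt_eqF.
have [s1 s2] := expR_small h0 h4.
have {}hc : [/\ 0 < c, `|1 - c^-1| <= 2 * h, `|1 - c| <= 1 / 2 & c `^ al <= expR (al * h)].
  case: hc => ->; rewrite expR_gt0 expR_powR -expRN ?opprK; split => //; try lra.
  by rewrite ler_expR mulrN; have := mulr_gt0 al0 h0; lra.
have [cgt0 cinv c12 cal] := hc.
have Ch0 : 0 < C * h by rewrite mulr_gt0.
(* The solution of A(m+1) = C h + A(m) / 2 that starts above ln D, the modulus given by [doubling];
   its limit 2 C h is linear in h. *)
pose A m := 2 * (C * h) + A0 / 2 ^+ m.
have p2 m : 0 < 2 ^+ m :> R by rewrite exprn_gt0.
have Age0 m : 0 <= A m.
  by rewrite /A addr_ge0 ?divr_ge0 ?(ltW (p2 m))// mulr_ge0// ltW.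
have AB m : A m <= B.
  rewrite /A /B addrC; apply: lerD; last by lra.
  by rewrite ler_pdivrMr// ler_peMr// exprn_ege1// ler1n.
have AS m : A m.+1 = C * h + A m / 2.
  by rewrite /A exprS invfM; lra.
pose Q := expR (C * h).
have H1 : 1 + `|1 - c^-1| / eps <= 1 + 2 * h / eps by rewrite lerD2l ler_pM2r ?invr_gt0.
have HQ : (1 + 2 * h / eps) `^ (N - al) <= Q.
  apply: (@le_trans _ _ (expR (2 * h / eps) `^ (N - al))).
    apply: le_powR2; [lra| |exact: expR_ge1Dx].
    by rewrite addr_ge0// divr_ge0 ?(ltW e0)// mulr_ge0// ltW.
  rewrite expR_powR ler_expR (_ : (N - al) * (2 * h / eps) = (N - al) * (2 / eps) * h);
    last by ring.
  by rewrite ler_pM2r// /C; lra.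
have cQ : c `^ al <= Q.
  by apply: (le_trans cal); rewrite ler_expR ler_pM2r// /C; lra.
have half f g r m : 0 < r -> mfun g -> (forall x, 0 < f x) -> (forall x, 0 < g x) ->
    doubling g D -> riesz_of al (fun y => g y `^ r) f ->
    (D `^ r) ^+ 2 * (2 * eps) `^ al * r * expR (r * B) <= 1 / 2 ->
    (forall x : 'rV[R]_n, g (c *: x) <= expR (A m) * g x) ->
    forall x : 'rV[R]_n, f (c *: x) <= expR (A m.+1) * f x.
  move=> r0 mg f0 g0 dg pot dr hg x.
  have [->|x0] := eqVneq x 0.
    rewrite scaler0; apply: ler_peMl; first exact: ltW.
    by rewrite -[leLHS]expR0 ler_expR.
  have G1 : 1 <= expR (r * A m).
    by rewrite -[leLHS]expR0 ler_expR mulr_ge0// ltW.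
  have mgr : mfun (fun y => g y `^ r) by exact: measurable_powR_comp.
  have g0' y : 0 <= g y by exact: ltW.
  have dgr := doubling_powR g0' (ltW D0) (ltW r0) dg.
  have gr0 : forall y, 0 <= g y `^ r by move=> y; exact: powR_ge0.
  have gG (y : 'rV[R]_n) : g (c *: y) `^ r <= expR (r * A m) * g y `^ r.
    rewrite -expR_powR -powRM ?expR_ge0//; apply: le_powR2 => //; exact: ltW.
  have := dilation_step n_gt0 alN e0 e1 mgr gr0 pot (powR_ge0 D r) dgr cgt0 H1 HQ cQ G1 gG x0.
  move=> hs; apply: (le_trans hs); rewrite ler_pM2r// AS expRD ler_pM2l ?expR_gt0//.
  apply: (contraction_bound _ r0 (Age0 m) (AB m) dr).
  by rewrite mulr_ge0 ?powR_ge0// exprn_ge0// powR_ge0.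
(* Both functions are carried along together, since each equation controls one modulus by the
   other. *)
have iter m : forall x : 'rV[R]_n, u (c *: x) <= expR (A m) * u x /\
    v (c *: x) <= expR (A m) * v x.
  elim: m => [|m IH] x.
    have near : enorm (c *: x - x) <= enorm x / 2.
      rewrite (_ : c *: x - x = (c - 1) *: x); last by rewrite scalerBl scale1r.
      rewrite enormZ distrC mulrC; apply: ler_wpM2l; [exact: enorm_ge0|lra].
    have DA : D <= expR (A 0%N).
      by rewrite DE ler_expR /A expr0 divr1; lra.
    have [hu _] := du _ _ near; have [hv _] := dv _ _ near.
    by split; [apply: (le_trans hu)|apply: (le_trans hv)]; rewrite ler_pM2r.
  split.
    by apply: (half u v q m) => // y; have [] := IH y.
  by apply: (half v u p m) => // y; have [] := IH y.
have lim f (x : 'rV[R]_n) : (forall x, 0 < f x) ->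
    (forall m, f (c *: x) <= expR (A m) * f x) -> f (c *: x) <= expR (2 * C * h) * f x.
  move=> f0 hf; rewrite -ler_pdivrMr// -[leLHS]lnK; last by rewrite posrE divr_gt0.
  rewrite ler_expR; apply: (@le_limit_halves _ _ _ A0) => m.
  rewrite -ler_expR lnK; last by rewrite posrE divr_gt0.
  by rewrite ler_pdivrMr// -mulrA; exact: hf.
by move=> x; split; apply: lim => // m; have [] := iter m x.
Qed.

End dilation_lipschitz.

(** * Pohozaev identity *)

Section pohozaev.
Context (R : realType) (n : nat) (n_gt0 : (0 < n)%N).
Implicit Types f g u v : Rn R n -> R.

Local Notation J f := (\int[leb R n]_x (f x)%:E)%E.
Local Notation mfun f := (measurable_fun [set: Rn R n] f).
Local Notation N := (n%:R).

(** Tonelli and the symmetry of the kernel. Substituting x -> c x produces c^(n - al) from the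
    kernel and c^(-n) from the measure, together c^(-al). *)
Lemma riesz_exchange (al c : R) f g u v : 0 < c -> mfun f -> mfun g -> mfun v ->
  (forall x, 0 <= f x) -> (forall x, 0 <= g x) -> (forall x, 0 <= v x) ->
  riesz_of al g u -> riesz_of al f v ->
  (J (fun x => f (c *: (x : 'rV_n)) * u x)%R =
   (c `^ (- al))%:E * J (fun y => g y * v (c *: (y : 'rV_n)))%R)%E.
Proof.
move=> c0 mf mg mv f0 g0 v0 potu potv.
pose F (x y : Rn R n) := f (c *: (x : 'rV_n)) *
  (g y * enorm ((x : 'rV_n) - (y : 'rV_n)) `^ (al - N)).
have F0 x y : 0 <= F x y by rewrite !mulr_ge0 ?powR_ge0.
have mF : measurable_fun [set: Rn R n * Rn R n] (fun z => F z.1 z.2).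
  apply: measurable_funM.
    exact: (measurableT_comp (measurable_scale_comp c mf) measurable_fst).
  apply: measurable_funM; first exact: (measurableT_comp mg measurable_snd).
  apply: (measurableT_comp (measurable_powR (al - N))).
  apply: (measurableT_comp (@measurable_enorm R n)).
  exact: (measurable_sub_Rn measurable_fst measurable_snd).
transitivity (\int[leb R n]_x \int[leb R n]_y (F x y)%:E)%E.
  apply: eq_integral => x _; rewrite EFinM (potu x) -JZ.
  - by [].
  - exact: measurable_riesz_integrand.
  - by move=> y; rewrite mulr_ge0 ?powR_ge0.
  - exact: f0.
rewrite (J_swap mF F0) -JZ.
- apply: eq_integral => y _.
  pose P (X : Rn R n) := f X * enorm ((c *: (y : 'rV_n)) - (X : 'rV_n)) `^ (al - N).
  have P0 X : 0 <= P X by rewrite mulr_ge0 ?powR_ge0.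
  have mP : mfun P by exact: measurable_riesz_integrand.
  have cg0 : 0 <= g y * c `^ (N - al) by rewrite mulr_ge0 ?powR_ge0.
  have cc : c `^ (N - al) * c `^ (al - N) = 1.
    by rewrite -powR_split ?gt_eqF// (_ : N - al + (al - N) = 0) ?powRr0//; ring.
  have FP x : F x y = g y * c `^ (N - al) * P (c *: (x : 'rV_n)).
    rewrite /F /P -scalerBr enormZ (gtr0_norm c0) (powRM _ (ltW c0) (enorm_ge0 _)).
    rewrite (enormC (y : 'rV_n)); set d := enorm _ `^ _; set e := f _.
    by rewrite -[LHS]mul1r -[X in X * _ = _]cc; ring.
  under eq_integral do rewrite FP.
  rewrite (JZ (measurable_scale_comp c mP) (fun x => P0 _) cg0) (J_scale mP P0 c0).
  rewrite -(potv (c *: (y : 'rV_n))) -!EFinM; congr EFin.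
  have -> : c `^ (- al) = c `^ (N - al) * c^-1 ^+ n.
    rewrite exprVn -(powR_mulrn n (ltW c0)) -powRN -powR_split ?gt_eqF//.
    by congr (_ `^ _); ring.
  by ring.
- by apply: measurable_funM; [exact: mg|exact: measurable_scale_comp].
- by move=> y; rewrite mulr_ge0.
- exact: powR_ge0.
Qed.

(** Squaring e^(z/2) <= 1 / (1 - z/2) reduces the claim to a polynomial inequality on |z| <= 1/2. *)
Lemma expR_quadratic (z : R) : `|z| <= 1 / 2 -> expR z <= 1 + z + 2 * z ^+ 2.
Proof.
rewrite ler_norml => /andP[z1 z2].
have e0 := expR_gt0 (z / 2).
have h : 1 - z / 2 <= (expR (z / 2))^-1.
  by rewrite -expRN; have := expR_ge1Dx (- (z / 2)); lra.
have h1 : (1 - z / 2) * expR (z / 2) <= 1.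
  by rewrite -ler_pdivlMr// div1r.
have -> : expR z = expR (z / 2) ^+ 2.
  by rewrite expr2 -expRD; congr expR; lra.
have a0 : 0 < 1 - z / 2 by lra.
have h2 : ((1 - z / 2) * expR (z / 2)) ^+ 2 <= 1.
  by rewrite expr_le1// mulr_ge0// ltW.
have h3 : 1 <= (1 - z / 2) ^+ 2 * (1 + z + 2 * z ^+ 2).
  rewrite (_ : _ * (1 + z + _) = 1 + z ^+ 2 * (5 / 4 - 7 / 4 * z + z ^+ 2 / 2)); last by field.
  have zz := sqr_ge0 z.
  by rewrite lerDl mulr_ge0//; lra.
have : (1 - z / 2) ^+ 2 * expR (z / 2) ^+ 2 <= (1 - z / 2) ^+ 2 * (1 + z + 2 * z ^+ 2).
  by rewrite -exprMn; apply: le_trans h3.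
by rewrite ler_pM2l// exprn_gt0.
Qed.

(* Young's inequality is an equality to second order near r = 1. *)
Lemma young_defect (a b y : R) : 0 < a -> 0 < b -> `|(a + b) * y| <= 1 / 2 ->
  `|expR (a * y) - (a / (a + b) * expR ((a + b) * y) + b / (a + b))|
    <= 2 * (a + b) ^+ 2 * y ^+ 2.
Proof.
move=> a0 b0 hy; set s := a + b in hy *.
have s0 : 0 < s by rewrite /s; lra.
have as0 : 0 < a / s by rewrite divr_gt0.
have a1 : a / s <= 1 by rewrite ler_pdivrMr// /s; lra.
have hb : b / s = 1 - a / s by rewrite /s; field; rewrite gt_eqF.
have hay : `|a * y| <= 1 / 2.
  apply: le_trans hy; rewrite !normrM (gtr0_norm a0) (gtr0_norm s0) ler_wpM2r//.
  by rewrite /s; lra.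
have u1 := expR_quadratic hy; have u2 := expR_quadratic hay.
have l1 := expR_ge1Dx (s * y); have l2 := expR_ge1Dx (a * y).
have m1 : a / s * expR (s * y) <= a / s * (1 + s * y + 2 * (s * y) ^+ 2) by rewrite ler_pM2l.
have m2 : a / s * (1 + s * y) <= a / s * expR (s * y) by rewrite ler_pM2l.
have e1 : a / s * (1 + s * y + 2 * (s * y) ^+ 2) = a / s + a * y + 2 * (a * s) * y ^+ 2.
  by field; rewrite gt_eqF.
have e2 : a / s * (1 + s * y) = a / s + a * y by field; rewrite gt_eqF.
rewrite {}e1 in m1; rewrite {}e2 in m2; rewrite exprMn in u2.
have y2 := sqr_ge0 y.
have b1 : (a * s) * y ^+ 2 <= s ^+ 2 * y ^+ 2.
  by rewrite ler_wpM2r// expr2 ler_pM2r// /s; lra.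
have b2 : a ^+ 2 * y ^+ 2 <= s ^+ 2 * y ^+ 2.
  by rewrite ler_wpM2r// ler_pXn2r ?nnegrE ?(ltW a0) ?(ltW s0)// /s; lra.
by rewrite hb ler_norml; apply/andP; split; lra.
Qed.

(** [young_defect] at y = ln (f(c x) / f(x)), multiplied by f(x)^(a + b) and integrated. The dilated
    pure power integrates exactly to c^(-n) E, so only a uniform bound on the ratio is used, not
    differentiability. *)
Lemma mixed_integral (a b L h c E : R) f : 0 < a -> 0 < b -> 0 <= L -> 0 < h -> 0 < c ->
  mfun f -> (forall x, 0 < f x) -> J (fun x => f x `^ (a + b)) = E%:E ->
  (forall x : 'rV[R]_n, f (c *: x) <= expR (L * h) * f x) ->
  (forall x : 'rV[R]_n, f x <= expR (L * h) * f (c *: x)) ->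
  (a + b) * (L * h) <= 1 / 2 ->
  exists2 G : R, J (fun x => f (c *: (x : 'rV_n)) `^ a * f x `^ b) = G%:E &
  `|G - (a / (a + b) * c^-1 ^+ n + b / (a + b)) * E| <= 2 * (a + b) ^+ 2 * L ^+ 2 * h ^+ 2 * E.
Proof.
move=> a0 b0 L0 h0 c0 mf f0 JE up lo small; set s := a + b in JE small *.
have s0 : 0 < s by rewrite /s; lra.
have as0 : 0 <= a / s by rewrite divr_ge0 ?ltW.
have bs0 : 0 <= b / s by rewrite divr_ge0 ?ltW.
pose M := 2 * s ^+ 2 * L ^+ 2 * h ^+ 2.
have M0 : 0 <= M.
  have t1 := sqr_ge0 s; have t2 := sqr_ge0 L; have t3 := sqr_ge0 h.
  by rewrite /M; apply: mulr_ge0 => //; apply: mulr_ge0 => //; exact: mulr_ge0.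
pose Fs (x : Rn R n) := f x `^ s.
pose Fc (x : Rn R n) := Fs (c *: (x : 'rV_n)).
pose X (x : Rn R n) := f (c *: (x : 'rV_n)) `^ a * f x `^ b.
have point x : `|X x - (a / s * Fc x + b / s * Fs x)| <= M * Fs x.
  have fx := f0 x; have fcx : 0 < f (c *: (x : 'rV_n)) by exact: f0.
  pose r := f (c *: (x : 'rV_n)) / f x; have r0 : 0 < r by rewrite divr_gt0.
  pose y := ln r.
  have fE : f (c *: (x : 'rV_n)) = r * f x by rewrite /r divfK// gt_eqF.
  have rE e : r `^ e = expR (e * y) by rewrite /powR gt_eqF.
  have ya : `|y| <= L * h.
    rewrite ler_norml; apply/andP; split.
      rewrite -ler_expR /y lnK ?posrE// expRN /r ler_pdivlMr//.
      by rewrite mulrC ler_pdivrMr ?expR_gt0// mulrC; exact: lo.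
    by rewrite -ler_expR /y lnK ?posrE// /r ler_pdivrMr//; exact: up.
  have hy : `|(a + b) * y| <= 1 / 2.
    rewrite normrM gtr0_norm//; apply: le_trans small.
    by rewrite ler_pM2l.
  have := young_defect a0 b0 hy; rewrite -/s => yd.
  have -> : X x - (a / s * Fc x + b / s * Fs x) =
      (expR (a * y) - (a / s * expR (s * y) + b / s)) * Fs x.
    rewrite /X /Fc /Fs fE !(powRM _ (ltW r0) (ltW fx)) !rE.
    by rewrite {3 5 6}/s powR_split ?gt_eqF//; ring.
  rewrite normrM (ger0_norm (powR_ge0 _ _ : 0 <= Fs x)) ler_wpM2r ?powR_ge0//.
  apply: (le_trans yd); rewrite /M -[leRHS]mulrA -exprMn ler_wpM2l//.
    by rewrite mulr_ge0// sqr_ge0.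
  rewrite -(real_normK (num_real y)) ler_pXn2r ?nnegrE//.
  by rewrite mulr_ge0// ltW.
have X0 x : 0 <= X x by rewrite mulr_ge0 ?powR_ge0.
have Fs0 x : 0 <= Fs x := powR_ge0 _ _.
have Fc0 x : 0 <= Fc x := powR_ge0 _ _.
have mFs : mfun Fs by exact: measurable_powR_comp.
have mFc : mfun Fc by exact: (measurable_scale_comp c mFs).
have mX : mfun X.
  apply: measurable_funM; apply: measurable_powR_comp => //.
  exact: (measurable_scale_comp c mf).
have JFs : J Fs = E%:E by exact: JE.
have E0 : 0 <= E by rewrite -lee_fin -JFs; exact: J_ge0.
have JFc : J Fc = (c^-1 ^+ n * E)%:E by rewrite (J_scale mFs Fs0 c0) JFs.
pose T (x : Rn R n) := a / s * Fc x + b / s * Fs x.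
have mc k g : mfun g -> mfun (fun x => k * g x).
  by move=> mg; apply: measurable_funM; [exact: measurable_cst|exact: mg].
have mT : mfun T by apply: measurable_funD; exact: mc.
have T0 x : 0 <= T x by rewrite addr_ge0// mulr_ge0.
have JT : J T = ((a / s * c^-1 ^+ n + b / s) * E)%:E.
  rewrite (JD (mc _ _ mFc) (mc _ _ mFs) (fun x => mulr_ge0 as0 (Fc0 x))
    (fun x => mulr_ge0 bs0 (Fs0 x))).
  rewrite (JZ mFc Fc0 as0) (JZ mFs Fs0 bs0) JFc JFs -!EFinM -EFinD.
  by congr EFin; ring.
have JM : J (fun x => M * Fs x) = (M * E)%:E by rewrite (JZ mFs Fs0 M0) JFs -EFinM.
have MF0 x : 0 <= M * Fs x by rewrite mulr_ge0.
have u1 : (J X <= ((a / s * c^-1 ^+ n + b / s) * E + M * E)%:E)%E.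
  rewrite EFinD -JT -JM -(JD mT (mc _ _ mFs) T0 MF0).
  apply: (le_J n_gt0 (a := 0 : 'rV_n)) => //.
  - by apply: measurable_funD => //; exact: mc.
  - by move=> x; rewrite addr_ge0.
  by move=> x _; have := point x; rewrite ler_norml /T => /andP[_]; lra.
have u2 : (((a / s * c^-1 ^+ n + b / s) * E)%:E <= J X + (M * E)%:E)%E.
  rewrite -JT -JM -(JD mX (mc _ _ mFs) X0 MF0).
  apply: (le_J n_gt0 (a := 0 : 'rV_n)) => //.
  - by apply: measurable_funD => //; exact: mc.
  - by move=> x; rewrite addr_ge0.
  by move=> x _; have := point x; rewrite ler_norml /T => /andP[+ _]; lra.
have := J_ge0 X0; move: u1 u2; rewrite -/X.
case JX : (J X) => [G| |]//; rewrite -EFinD !lee_fin => u1 u2 _.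
exists G; first by rewrite -JX.
by rewrite ler_norml -/M; apply/andP; split; lra.
Qed.

Lemma eq0_of_le_sqr (X M h1 : R) : 0 < h1 ->
  (forall h, 0 < h -> h <= h1 -> `|X * h| <= M * h ^+ 2) -> X = 0.
Proof.
move=> h10 H; apply/eqP; rewrite -normr_le0 leNgt; apply/negP => X0.
pose h := Num.min h1 (`|X| / (2 * (`|M| + 1))).
have M1 : 0 < `|M| + 1 by have := normr_ge0 M; lra.
have h0 : 0 < h by rewrite lt_min h10 /=; apply: divr_gt0 => //; exact: mulr_gt0.
have := H h h0 (ltac:(by rewrite ge_min lexx)).
rewrite normrM (gtr0_norm h0) expr2 mulrA ler_pM2r// => le1.
have hX : h * (2 * (`|M| + 1)) <= `|X|.
  by rewrite -ler_pdivlMr ?mulr_gt0// ge_min lexx orbT.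
have le2 : M * h <= (`|M| + 1) * h by rewrite ler_pM2r//; have := ler_norm M; lra.
by lra.
Qed.

(** The real arithmetic of the expansion: [x1] and [x2] stand for e^(-d h) and e^(-al h), [a1] and
    [b1] for the Young weights, [ga] and [ka] for the relative errors of the two mixed integrals.
    Cancelling the constant terms of the exchange identity leaves the linear one. *)
Lemma second_order_bound (al d a1 b1 M1 M2 h x1 x2 ga ka : R) :
  0 <= al -> 0 <= d -> 0 <= a1 -> a1 <= 1 -> 0 <= b1 -> b1 <= 1 -> 0 <= M2 ->
  0 < h -> h <= 1 ->
  1 + - (d * h) <= x1 -> x1 <= 1 - d * h + 2 * (d * h) ^+ 2 -> 0 <= x1 -> x1 <= 1 ->
  1 + - (al * h) <= x2 -> x2 <= 1 - al * h + 2 * (al * h) ^+ 2 ->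
  `|ga| <= M1 * h ^+ 2 -> `|ka| <= M2 * h ^+ 2 ->
  a1 * x1 + (1 - a1) + ga = x2 * (b1 * x1 + (1 - b1) + ka) ->
  `|(a1 * d - (al + b1 * d)) * h| <= (2 * d ^+ 2 + M1 + 2 * d ^+ 2 + M2 +
     al * (d + M2) + 2 * al ^+ 2 * (1 + M2)) * h ^+ 2.
Proof.
move=> al0 d0 a10 a11 b10 b11 M20 hp hle1 EN1 EN2 x10 x1u Ea1 Ea2.
rewrite !ler_norml => /andP[ga1 ga2] /andP[ka1 ka2] key.
pose r1 := x1 - 1 + d * h; pose r2 := x2 - 1 + al * h.
have r10 : 0 <= r1 by rewrite /r1; lra.
have r1u : r1 <= 2 * d ^+ 2 * h ^+ 2 by rewrite -mulrA -exprMn /r1; lra.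
have r20 : 0 <= r2 by rewrite /r2; lra.
have r2u : r2 <= 2 * al ^+ 2 * h ^+ 2 by rewrite -mulrA -exprMn /r2; lra.
have x1h : 1 - x1 <= d * h by lra.
pose psi := b1 * x1 + (1 - b1) + ka.
pose t1 := a1 * r1; pose t2 := b1 * r1; pose t3 := al * h * (psi - 1); pose t4 := r2 * psi.
(* The linear coefficient is rewritten, through [key], as a sum of terms each of second order in h;
   [r1] and [r2] are the Taylor remainders of the two exponentials. *)
have -> : (a1 * d - (al + b1 * d)) * h = t1 + ga - t2 - ka + t3 - t4.
  rewrite /t1 /t2 /t3 /t4 /r1 /r2 -/psi in key *.
  have E : a1 * x1 + (1 - a1) + ga - x2 * psi = 0 by rewrite key subrr.
  by rewrite -[LHS]addr0 -E /psi; ring.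
have [psil psiu] : - ((d + M2) * h) <= psi - 1 /\ psi - 1 <= (d + M2) * h.
  have M2h : M2 * h ^+ 2 <= M2 * h by rewrite ler_wpM2l// expr2 ler_piMl// ltW.
  have bx : b1 * (1 - x1) <= d * h.
    by apply: le_trans x1h; rewrite ler_piMl// subr_ge0.
  have bx0 : 0 <= b1 * (1 - x1) by rewrite mulr_ge0// subr_ge0.
  have dh0 : 0 <= d * h by rewrite mulr_ge0// ltW.
  clear - ka1 ka2 M2h bx bx0 dh0.
  by rewrite /psi; split; lra.
have [psiL psiU] : - (1 + M2) <= psi /\ psi <= 1 + M2.
  have M2h : M2 * h ^+ 2 <= M2 by rewrite ler_piMr// exprn_ile1// ltW.
  have bx : b1 * x1 <= b1 by rewrite ler_piMr.
  have bx0 : 0 <= b1 * x1 by rewrite mulr_ge0.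
  clear - ka1 ka2 M2h bx bx0 b10 b11.
  by rewrite /psi; split; lra.
have t10 : 0 <= t1 by rewrite mulr_ge0.
have t1u : t1 <= 2 * d ^+ 2 * h ^+ 2 by apply: le_trans r1u; rewrite ler_piMl.
have t20 : 0 <= t2 by rewrite mulr_ge0.
have t2u : t2 <= 2 * d ^+ 2 * h ^+ 2 by apply: le_trans r1u; rewrite ler_piMl.
have alh0 : 0 <= al * h by rewrite mulr_ge0// ltW.
have t3u : t3 <= al * (d + M2) * h ^+ 2.
  rewrite (_ : al * (d + M2) * h ^+ 2 = al * h * ((d + M2) * h)); last by ring.
  by rewrite ler_wpM2l.
have t3l : - (al * (d + M2) * h ^+ 2) <= t3.
  rewrite (_ : - (al * (d + M2) * h ^+ 2) = al * h * - ((d + M2) * h)); last by ring.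
  by rewrite ler_wpM2l.
have M21 : 0 <= 1 + M2 by rewrite addr_ge0.
have t4b : r2 * (1 + M2) <= 2 * al ^+ 2 * (1 + M2) * h ^+ 2.
  rewrite (_ : 2 * al ^+ 2 * (1 + M2) * h ^+ 2 = 2 * al ^+ 2 * h ^+ 2 * (1 + M2)); last by ring.
  by rewrite ler_wpM2r.
have t4u : t4 <= 2 * al ^+ 2 * (1 + M2) * h ^+ 2.
  by apply: le_trans t4b; rewrite ler_wpM2l.
have t4l : - (2 * al ^+ 2 * (1 + M2) * h ^+ 2) <= t4.
  by rewrite lerNl; apply: le_trans t4b; rewrite -mulrN ler_wpM2l// lerNl.
clearbody t1 t2 t3 t4.
clear - ga1 ga2 ka1 ka2 t10 t1u t20 t2u t3u t3l t4u t4l.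
by rewrite !mulrDl; apply/andP; split; lra.
Qed.

Lemma pohozaev_identity (al p q D E : R) u v : 0 < al -> al < N -> 0 < p -> 0 < q ->
  mfun u -> mfun v -> (forall x, 0 < u x) -> (forall x, 0 < v x) ->
  riesz_of al (fun y => v y `^ q) u -> riesz_of al (fun y => u y `^ p) v ->
  1 <= D -> doubling u D -> doubling v D -> 0 < E ->
  J (fun x => u x `^ (p + 1)) = E%:E -> J (fun x => v x `^ (q + 1)) = E%:E ->
  p / (p + 1) * N = al + 1 / (q + 1) * N.
Proof.
move=> al0 alN p0 q0 mu mv u0 v0 potu potv D1 du dv E0 JU JV.
have [L [h0 [L0 h00 lip]]] :=
  riesz_dilation_lipschitz n_gt0 al0 alN p0 q0 mu mv u0 v0 potu potv D1 du dv.
have JV' : J (fun x => v x `^ (1 + q)) = E%:E by rewrite -JV addrC.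
pose M1 := 2 * (p + 1) ^+ 2 * L ^+ 2; pose M2 := 2 * (1 + q) ^+ 2 * L ^+ 2.
have M10 : 0 <= M1 by apply: mulr_ge0; [apply: mulr_ge0 => //|]; exact: sqr_ge0.
have M20 : 0 <= M2 by apply: mulr_ge0; [apply: mulr_ge0 => //|]; exact: sqr_ge0.
(* [Z] dominates every coefficient that multiplies h below, so the single condition Z h <= 1/2
   covers all smallness requirements. *)
pose Z := (p + 1 + (1 + q)) * (L + 1) + N + al.
have N0 : 0 <= N :> R by exact: ler0n.
have Z1 : (p + 1) * L <= Z.
  have : 0 <= (1 + q) * (L + 1) by apply: mulr_ge0; lra.
  by rewrite /Z; lra.
have Z2 : (1 + q) * L <= Z.
  have : 0 <= (p + 1) * (L + 1) by apply: mulr_ge0; lra.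
  by rewrite /Z; lra.
have ZZ : 0 <= (p + 1 + (1 + q)) * (L + 1) by apply: mulr_ge0; lra.
have Z0 : 0 < Z by rewrite /Z; lra.
have ZN : N <= Z by rewrite /Z; lra.
have Zal : al <= Z by rewrite /Z; lra.
pose h1 := Num.min 1 (Num.min h0 (2 * Z)^-1).
have h10 : 0 < h1 by rewrite !lt_min ltr01 h00 invr_gt0 mulr_gt0.
pose M := 2 * N ^+ 2 + M1 + 2 * N ^+ 2 + M2 + al * (N + M2) + 2 * al ^+ 2 * (1 + M2).
apply/eqP; rewrite -subr_eq0; apply/eqP; apply: (@eq0_of_le_sqr _ M h1 h10) => h hp hh.
have hle1 : h <= 1 by apply: le_trans hh _; rewrite ge_min lexx.
have hle0 : h <= h0 by apply: le_trans hh _; rewrite !ge_min lexx orbT.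
have hZ : Z * h <= 1 / 2.
  have : h <= (2 * Z)^-1 by apply: le_trans hh _; rewrite !ge_min lexx !orbT.
  rewrite invfM -(ler_pM2l Z0) mulrCA mulfV ?gt_eqF// mulr1; lra.
have small e : 0 <= e -> e <= Z -> e * h <= 1 / 2.
  by move=> e1 e2; apply: le_trans hZ; rewrite ler_pM2r.
pose c := expR h; have c0 : 0 < c := expR_gt0 h.
have up x := lip h c hp hle0 (or_introl erefl) x.
(* The reverse bound is the forward one for the inverse dilation, applied at the point c x. *)
have lo (x : 'rV[R]_n) : u x <= expR (L * h) * u (c *: x) /\ v x <= expR (L * h) * v (c *: x).
  have := lip h (expR (- h)) hp hle0 (or_intror erefl) (c *: x).
  by rewrite scalerA -expRD addNr expR0 scale1r.
have [G GE Gb] : exists2 G : R, J (fun x => u (c *: (x : 'rV_n)) `^ p * u x `^ 1) = G%:E &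
    `|G - (p / (p + 1) * c^-1 ^+ n + 1 / (p + 1)) * E| <= M1 * h ^+ 2 * E.
  apply: (mixed_integral p0 ltr01 L0 hp c0 mu u0 JU).
  - by move=> x; have [] := up x.
  - by move=> x; have [] := lo x.
  - by rewrite mulrA small// mulr_ge0//; lra.
have [K KE Kb] : exists2 K : R, J (fun x => v (c *: (x : 'rV_n)) `^ 1 * v x `^ q) = K%:E &
    `|K - (1 / (1 + q) * c^-1 ^+ n + q / (1 + q)) * E| <= M2 * h ^+ 2 * E.
  apply: (mixed_integral ltr01 q0 L0 hp c0 mv v0 JV').
  - by move=> x; have [_] := up x.
  - by move=> x; have [_] := lo x.
  - by rewrite mulrA small// mulr_ge0//; lra.
have cal : c `^ (- al) = expR (- (al * h)) by rewrite /c expR_powR mulNr.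
have GK : G = expR (- (al * h)) * K.
  apply: EFin_inj; rewrite EFinM -cal -KE -GE.
  have := @riesz_exchange al c (fun y => u y `^ p) (fun y => v y `^ q) u v c0
    (measurable_powR_comp p mu) (measurable_powR_comp q mv) mv
    (fun x => powR_ge0 _ _) (fun x => powR_ge0 _ _) (fun x => ltW (v0 x)) potu potv.
  have -> : J (fun x => u (c *: (x : 'rV_n)) `^ p * u x)%R =
            J (fun x => u (c *: (x : 'rV_n)) `^ p * u x `^ 1)%R.
    by apply: eq_integral => x _; rewrite powRr1// ltW.
  move=> ->; congr (_ * _)%E; apply: eq_integral => x _; congr EFin.
  by rewrite powRr1 1?mulrC// ltW.
have cn : c^-1 ^+ n = expR (- (N * h)).
  by rewrite exprVn /c -expRM_natl expRN mulr_natl.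
rewrite {}cn in Gb Kb.
have EN1 := expR_ge1Dx (- (N * h)).
have EN2 : expR (- (N * h)) <= 1 - N * h + 2 * (N * h) ^+ 2.
  by have := @expR_quadratic (- (N * h)); rewrite normrN sqrrN; apply;
    rewrite ger0_norm ?mulr_ge0 ?(ltW hp)// small.
have Ea1 := expR_ge1Dx (- (al * h)).
have Ea2 : expR (- (al * h)) <= 1 - al * h + 2 * (al * h) ^+ 2.
  by have := @expR_quadratic (- (al * h)); rewrite normrN sqrrN; apply;
    rewrite ger0_norm ?mulr_ge0 ?(ltW hp) ?(ltW al0)// small// ltW.
set x1 := expR (- (N * h)) in Gb Kb EN1 EN2; set x2 := expR (- (al * h)) in GK Ea1 Ea2.
pose a1 := p / (p + 1); pose b1 := 1 / (q + 1).
have a1E : 1 / (p + 1) = 1 - a1 by rewrite /a1; field; rewrite gt_eqF//; lra.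
have b1E : q / (1 + q) = 1 - b1 by rewrite /b1; field; rewrite !gt_eqF//; lra.
have b1E' : 1 / (1 + q) = b1 by rewrite /b1 addrC.
have a10 : 0 <= a1 by rewrite divr_ge0 ?addr_ge0// ltW.
have a11 : a1 <= 1 by rewrite ler_pdivrMr ?addr_gt0// mul1r lerDl.
have b10 : 0 <= b1 by rewrite divr_ge0// addr_ge0// ltW.
have b11 : b1 <= 1 by rewrite ler_pdivrMr ?addr_gt0// mul1r lerDr ltW.
rewrite -/a1 a1E in Gb; rewrite b1E b1E' in Kb; rewrite -/a1 -/b1.
(* Dividing by [E], finite and positive, makes the errors relative. *)
pose ga := G / E - (a1 * x1 + (1 - a1)); pose ka := K / E - (b1 * x1 + (1 - b1)).
have En0 : E != 0 by rewrite gt_eqF.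
have gaB : `|ga| <= M1 * h ^+ 2.
  by rewrite -(ler_pM2r E0) -{1}(gtr0_norm E0) -normrM /ga mulrBl divfK.
have kaB : `|ka| <= M2 * h ^+ 2.
  by rewrite -(ler_pM2r E0) -{1}(gtr0_norm E0) -normrM /ka mulrBl divfK.
have key : a1 * x1 + (1 - a1) + ga = x2 * (b1 * x1 + (1 - b1) + ka).
  by rewrite /ga /ka GK; field.
have x1u : x1 <= 1.
  by rewrite -[leRHS]expR0 ler_expR oppr_le0 mulr_ge0// ltW.
have x10 : 0 <= x1 := expR_ge0 _.
exact: (second_order_bound (ltW al0) N0 a10 a11 b10 b11 M20 hp hle1 EN1 EN2 x10 x1u
  Ea1 Ea2 gaB kaB key).
Qed.

End pohozaev.

(** * Classification of decay rates *)

Section classification.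
Context (R : realType) (n : nat) (n_gt0 : (0 < n)%N).

Local Notation J f := (\int[leb R n]_x (f x)%:E)%E.
Local Notation mfun f := (measurable_fun [set: Rn R n] f).
Local Notation N := (n%:R).
Local Notation "<| x |>" := (1 + enorm x).

Lemma Rn_measurable_funP (f : Rn R n -> R) : Rn_measurable_fun f -> mfun f.
Proof. by move=> mf _ B mB; rewrite setTI; exact: mf. Qed.

Lemma asymp_equiv_enorm (f : 'rV[R]_n -> R) (th e : R) : e = - th ->
  asymp_equiv f (fun x => <|x|> `^ (- th)) -> asymp_equiv f (fun x => enorm x `^ e).
Proof.
move=> -> [C [C0 [R0 HC]]]; pose D : R := 2 `^ `|- th|.
have D0 : 0 < D by exact: powR_gt0.
exists (C * D); split; first by rewrite mulr_gt0.
exists (Num.max R0 1) => x; rewrite gt_max => /andP[hR h1].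
have [lo up] := HC x hR.
have d1 : <|x|> `^ (- th) <= D * enorm x `^ (- th) by apply: le_powR_double; lra.
have d2 : enorm x `^ (- th) <= D * <|x|> `^ (- th) by apply: le_powR_double; lra.
split.
  apply: le_trans lo; rewrite ler_pdivrMr ?mulr_gt0//.
  by rewrite mulrA divfK ?gt_eqF// mulrC.
by apply: (le_trans up); rewrite -mulrA ler_pM2l.
Qed.

Lemma comparable_energy_lty (f : Rn R n -> R) (th s : R) : 0 < s -> mfun f ->
  comparable_pow f th -> N < s * th -> (J (fun x => f x `^ s) < +oo)%E.
Proof.
move=> s0 mf cf Ns; have [C C0 HC] := comparable_powR s0 cf.
have m1 : mfun (fun x => <|x|> `^ (- (s * th))) := measurable_one_enorm _.
apply: (@le_lt_trans _ _ (J (fun x => C * <|x|> `^ (- (s * th)))%R)).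
  apply: (le_J n_gt0 (a := 0 : 'rV_n)).
  - exact: measurable_powR_comp.
  - by apply: measurable_funM; [exact: measurable_cst|exact: m1].
  - by move=> x; exact: powR_ge0.
  - by move=> x; rewrite mulr_ge0 ?powR_ge0// ltW.
  - by move=> x _; have [] := HC x.
rewrite (JZ m1 (fun x => powR_ge0 _ _) (ltW C0)).
by apply: lte_mul_pinfty; [rewrite lee_fin ltW|by []|exact: J_decay_lty].
Qed.

Lemma comparable_energy_gt0 (f : Rn R n -> R) (th s : R) : 0 < s -> 0 < th -> mfun f ->
  comparable_pow f th -> (0 < J (fun x => f x `^ s))%E.
Proof.
move=> s0 th0 mf cf; have [C C0 HC] := comparable_powR s0 cf.
have [V V0 HV] := ball_volume R n_gt0.
pose m := 2 `^ (- (s * th)) / C.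
have m0 : 0 < m by apply: divr_gt0 => //; exact: powR_gt0.
have mb := measurable_ball_fun (0 : 'rV[R]_n) (1 : R).
have b0 := ball_fun_ge0 (0 : 'rV[R]_n) (1 : R).
apply: (@lt_le_trans _ _ (J (fun x => m * ball_fun 0 1 x)%R)).
  rewrite (JZ mb b0 (ltW m0)) (HV _ _ ltr01) -EFinM lte_fin expr1n mulr1.
  exact: mulr_gt0.
apply: (le_J n_gt0 (a := 0 : 'rV_n)).
- by apply: measurable_funM; [exact: measurable_cst|exact: mb].
- exact: measurable_powR_comp.
- by move=> x; rewrite mulr_ge0// ltW.
- by move=> x; exact: powR_ge0.
move=> x _; rewrite /ball_fun subr0; case: ifP => h; last by rewrite mulr0 powR_ge0.
rewrite mulr1; have [h1 _] := HC x; apply: le_trans h1.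
rewrite ler_pM2r ?invr_gt0//; have x0 := enorm_ge0 x.
by apply: ge_powR2; [rewrite oppr_le0 mulr_ge0// ltW|lra|lra].
Qed.

Definition decaying_solution (al p q th1 th2 : R) (u v : Rn R n -> R) :=
  [/\ mfun u, mfun v, riesz_of al (fun y => v y `^ q) u & riesz_of al (fun y => u y `^ p) v] /\
  comparable_pow u th1 /\ comparable_pow v th2.

Lemma decaying_solution_sym al p q th1 th2 u v :
  decaying_solution al p q th1 th2 u v -> decaying_solution al q p th2 th1 v u.
Proof. by move=> [[? ? ? ?] [? ?]]. Qed.

Lemma decaying_exponents al p q th1 th2 u v : 0 < al -> al < N -> 0 < q ->
  0 < th1 -> 0 < th2 -> decaying_solution al p q th1 th2 u v ->
  [/\ th1 <= q * th2 - al, q * th2 < N -> th1 = q * th2 - al,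
      N <= q * th2 -> th1 = N - al & q * th2 <> N].
Proof.
move=> al0 alN q0 t1 t2 [[mu mv potu potv] [cu cv]].
apply: (riesz_exponent n_gt0 al0 alN _ t1 _ _ cu potu).
- exact: mulr_gt0.
- exact: measurable_powR_comp.
- exact: comparable_powR.
Qed.

(** Undilated, the exchange identity equates the two energies, so finiteness and positivity need
    checking for [u] only. *)
Lemma decaying_energy al p q th1 th2 u v : 0 < al -> al < N -> 0 < p -> 0 < q ->
  0 < th1 -> 0 < th2 -> decaying_solution al p q th1 th2 u v -> N < (p + 1) * th1 ->
  exists2 E : R, 0 < E &
    J (fun x => u x `^ (p + 1)) = E%:E /\ J (fun x => v x `^ (q + 1)) = E%:E.
Proof.
move=> al0 alN p0 q0 t1 t2 [[mu mv potu potv] [cu cv]] Nt.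
have p1 : 0 < p + 1 by lra.
have := comparable_energy_gt0 p1 t1 mu cu.
have := comparable_energy_lty p1 mu cu Nt.
have u0 x : 0 < u x := comparable_pow_gt0 x cu.
have v0 x : 0 < v x := comparable_pow_gt0 x cv.
have := @riesz_exchange R n al 1 (fun y => u y `^ p) (fun y => v y `^ q) u v ltr01
  (measurable_powR_comp p mu) (measurable_powR_comp q mv) mv
  (fun x => powR_ge0 _ _) (fun x => powR_ge0 _ _) (fun x => ltW (v0 x)) potu potv.
have powS r (t : R) : 0 < t -> t `^ r * t = t `^ (r + 1).
  by move=> t0; rewrite powR_split ?gt_eqF// powRr1// ltW.
under eq_integral do rewrite scale1r powS//.
under [in X in _ = X -> _]eq_integral do rewrite scale1r powS//.
rewrite powR1 mul1e => ->.
by case: (J (fun y => v y `^ (q + 1))) => // E _ E0; exists E.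
Qed.

Lemma decaying_critical al p q th1 th2 u v : 0 < al -> al < N -> 0 < p -> 0 < q ->
  0 < th1 -> 0 < th2 -> decaying_solution al p q th1 th2 u v -> N < (p + 1) * th1 ->
  1 / (p + 1) + 1 / (q + 1) = (N - al) / N.
Proof.
move=> al0 alN p0 q0 t1 t2 sol Nt.
have [E E0 [EU EV]] := decaying_energy al0 alN p0 q0 t1 t2 sol Nt.
move: sol => [[mu mv potu potv] [cu cv]].
have [D1 hD1 du] := comparable_doubling cu.
have [D2 hD2 dv] := comparable_doubling cv.
have u0 x : 0 < u x := comparable_pow_gt0 x cu.
have v0 x : 0 < v x := comparable_pow_gt0 x cv.
have mono (f : Rn R n -> R) D D' : (forall x, 0 < f x) ->
    D <= D' -> doubling f D -> doubling f D'.
  move=> f0 DD dbl x y /dbl[h1 h2].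
  by split; [apply: (le_trans h1)|apply: (le_trans h2)]; rewrite ler_pM2r.
pose D := Num.max D1 D2.
have D11 : 1 <= D by rewrite le_max hD1.
have duD : doubling u D by apply: (mono _ _ _ u0 _ du); rewrite le_max lexx.
have dvD : doubling v D by apply: (mono _ _ _ v0 _ dv); rewrite le_max lexx orbT.
have := pohozaev_identity n_gt0 al0 alN p0 q0 mu mv u0 v0 potu potv D11 duD dvD E0 EU EV.
have Nn : N != 0 :> R by rewrite pnatr_eq0 -lt0n.
have p1 : p + 1 != 0 by rewrite gt_eqF//; lra.
have q1 : q + 1 != 0 by rewrite gt_eqF//; lra.
have -> : p / (p + 1) = 1 - 1 / (p + 1) by field.
move=> h; rewrite (_ : (N - al) / N = 1 - al / N); last by field.
have -> : al = (1 - 1 / (p + 1)) * N - 1 / (q + 1) * N by rewrite h; ring.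
by field; rewrite ?Nn ?p1 ?q1.
Qed.

Lemma fast_decay al p q th1 th2 u v : 0 < al -> al < N -> 0 < p -> 0 < q ->
  0 < th1 -> 0 < th2 -> decaying_solution al p q th1 th2 u v ->
  asymp_equiv u (fun x => <|x|> `^ (- th1)) ->
  asymp_equiv v (fun x => <|x|> `^ (- th2)) ->
  N <= q * th2 \/ N <= p * th1 -> p <= q ->
  [/\ asymp_equiv u (fun x => enorm x `^ (al - N)),
      p * (N - al) > N -> asymp_equiv v (fun x => enorm x `^ (al - N)),
      p * (N - al) = N -> asymp_equiv v (fun x => enorm x `^ (al - N) * ln (enorm x)) &
      p * (N - al) < N -> asymp_equiv v (fun x => enorm x `^ ((al - N) * (p + 1) + N))].
Proof.
move=> al0 alN p0 q0 t1 t2 sol au av fast pq.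
have [_ e1 e2 _] := decaying_exponents al0 alN q0 t1 t2 sol.
have [_ f1 f2 f3] := decaying_exponents al0 alN p0 t2 t1 (decaying_solution_sym sol).
(* If q th2 < n, fastness must come from p th1 >= n, so th2 = n - al while th1 = q th2 - al < th2;
   then p th1 <= p th2 <= q th2 < n, a contradiction. *)
have th1E : th1 = N - al.
  have [/e2 //|lt] := leP N (q * th2).
  have big : N <= p * th1 by case: fast => //; rewrite leNgt lt.
  have t1E := e1 lt; have t2E := f2 big.
  have a1 : p * th1 <= p * th2 by rewrite ler_pM2l//; lra.
  have a2 : p * th2 <= q * th2 by rewrite ler_pM2r.
  by lra.
rewrite th1E in f1 f2 f3; split => [|gt|eq|lt].
- by apply: (asymp_equiv_enorm _ au); lra.
- by apply: (asymp_equiv_enorm _ av); rewrite (f2 (ltW gt)); lra.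
(* The logarithmic case cannot occur here: it would make p th1 equal to the excluded exponent n. *)
- by case: f3.
- by apply: (asymp_equiv_enorm _ av); rewrite (f1 lt); lra.
Qed.

Lemma solution_riesz_of (al r : R) (g w : Rn R n -> R) : mfun g ->
  (forall x, (w x)%:E = Rn_integral (fun y : 'rV[R]_n =>
     (g y `^ r * enorm (x - y) `^ (al - n%:R))%:E)) ->
  riesz_of al (fun y => g y `^ r) w.
Proof.
move=> mg Hw x; rewrite Hw (@Rn_integralE R n) //.
- apply/measurable_EFinP.
  by apply: measurable_riesz_integrand; exact: measurable_powR_comp.
- by move=> y; rewrite lee_fin mulr_ge0 ?powR_ge0.
Qed.

Lemma in_LrP (r E : R) (f : Rn R n -> R) : mfun f -> (forall x, 0 < f x) ->
  J (fun x => f x `^ r) = E%:E -> in_Lr r f.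
Proof.
move=> mf f0 JE; rewrite /in_Lr (@Rn_integralE R n).
- by under eq_integral do rewrite gtr0_norm//; rewrite JE ltry.
- apply/measurable_EFinP; apply: measurable_powR_comp.
  exact: measurableT_comp.
- by move=> y; rewrite lee_fin powR_ge0.
Qed.

Lemma solution_lower (al r th : R) (f w : Rn R n -> R) : al < N ->
  mfun f -> (forall x, 0 < f x) -> 0 < r -> 0 < th ->
  riesz_of al (fun y => f y `^ r) w ->
  asymp_equiv f (fun x => <|x|> `^ (- th)) ->
  exists2 c : R, 0 < c & forall x : 'rV[R]_n, c * <|x|> `^ (al - N) <= w x.
Proof.
move=> alN mf f0 r0 th0 pot [C [C0 [R0 HC]]].
apply: (@riesz_lower_far R n n_gt0 al alN (fun y => f y `^ r) w (r * th) (C `^ r) R0).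
- exact: measurable_powR_comp.
- by move=> y; exact: powR_ge0.
- exact: pot.
- by rewrite mulr_ge0// ltW.
- exact: powR_gt0.
move=> y /HC[lo _].
have -> : <|y|> `^ (- (r * th)) / C `^ r = (<|y|> `^ (- th) / C) `^ r.
  rewrite powRM ?powR_ge0 ?invr_ge0 ?(ltW C0)// -powRrM mulNr (mulrC th).
  by rewrite powRV ?(ltW C0)// (powRN C).
by apply: le_powR2 => //; [exact: ltW|rewrite divr_ge0 ?powR_ge0 ?ltW].
Qed.

(** Boundedness gives the upper bound on compact regions and the integral equation the positive
    lower bound, which upgrades the decay at infinity to a global comparison. *)
Lemma solution_comparable (al r th1 th2 : R) (f w : Rn R n -> R) : al < N ->
  mfun f -> (forall x, 0 < f x) -> 0 < r -> 0 < th1 -> 0 < th2 ->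
  riesz_of al (fun y => f y `^ r) w -> bounded_fun_Rn w ->
  asymp_equiv w (fun x => <|x|> `^ (- th1)) ->
  asymp_equiv f (fun x => <|x|> `^ (- th2)) ->
  comparable_pow w th1.
Proof.
move=> alN mf f0 r0 t1 t2 pot [M HM] aw af.
have [c c0 lo] := solution_lower alN mf f0 r0 t2 pot af.
apply: (@comparable_pow_of_asymp R n al alN w th1 c M c0 lo _ t1 aw) => x.
exact: le_trans (ler_norm _) (HM x).
Qed.

End classification.

Theorem theorem1p4 (R : realType) (n : nat) (alpha p q theta1 theta2 : R)
  (u v : 'rV[R]_n -> R) :
  (3 <= n)%N -> 0 < alpha -> alpha < n%:R ->
  0 < p -> 0 < q -> 1 < p * q ->
  positive_solution alpha p q u v ->
  bounded_fun_Rn u -> bounded_fun_Rn v ->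
  0 < theta1 -> 0 < theta2 ->
  asymp_equiv u (fun x => (1 + enorm x) `^ (- theta1)) ->
  asymp_equiv v (fun x => (1 + enorm x) `^ (- theta2)) ->
  let N := n%:R in
  [/\ 1 / (p + 1) + 1 / (q + 1) <= (N - alpha) / N,
      alpha * (q + 1) / (p * q - 1) <= theta1,
      alpha * (p + 1) / (p * q - 1) <= theta2,
      (alpha * (q + 1) / (p * q - 1) < theta1 \/
       alpha * (p + 1) / (p * q - 1) < theta2) ->
        [/\ 1 / (p + 1) + 1 / (q + 1) = (N - alpha) / N,
            in_Lr (p + 1) u, in_Lr (q + 1) v,
            p <= q ->
              [/\ asymp_equiv u (fun x => enorm x `^ (alpha - N)),
                  p * (N - alpha) > N ->
                    asymp_equiv v (fun x => enorm x `^ (alpha - N)),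
                  p * (N - alpha) = N ->
                    asymp_equiv v (fun x => enorm x `^ (alpha - N) * ln (enorm x)) &
                  p * (N - alpha) < N ->
                    asymp_equiv v (fun x => enorm x `^ ((alpha - N) * (p + 1) + N))] &
            q <= p ->
              [/\ asymp_equiv v (fun x => enorm x `^ (alpha - N)),
                  q * (N - alpha) > N ->
                    asymp_equiv u (fun x => enorm x `^ (alpha - N)),
                  q * (N - alpha) = N ->
                    asymp_equiv u (fun x => enorm x `^ (alpha - N) * ln (enorm x)) &
                  q * (N - alpha) < N ->
                    asymp_equiv u (fun x => enorm x `^ ((alpha - N) * (q + 1) + N))]] &
      1 / (p + 1) + 1 / (q + 1) < (N - alpha) / N ->
        theta1 = alpha * (q + 1) / (p * q - 1) /\
        theta2 = alpha * (p + 1) / (p * q - 1)].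
Proof.
move=> n3 al0 alN p0 q0 pq1 [u0 [v0 [mu' [mv' [potu' potv']]]]] bu bv t1 t2 au av N.
have n0 : (0 < n)%N by exact: leq_trans n3.
have mu := Rn_measurable_funP mu'; have mv := Rn_measurable_funP mv'.
have potu := solution_riesz_of mv potu'; have potv := solution_riesz_of mu potv'.
have cu := solution_comparable n0 alN mv v0 q0 t1 t2 potu bu au av.
have cv := solution_comparable n0 alN mu u0 p0 t2 t1 potv bv av au.
have sol : decaying_solution alpha p q theta1 theta2 u v by split.
have [le1 e1 e2 _] := decaying_exponents n0 al0 alN q0 t1 t2 sol.
have [le2 f1 f2 _] := decaying_exponents n0 al0 alN p0 t2 t1 (decaying_solution_sym sol).
have crit := decaying_critical n0 al0 alN p0 q0 t1 t2 sol.
have pq0 : 0 < p * q - 1 by lra.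
have N0 : 0 < N by rewrite /N ltr0n.
have p1 : 0 < p + 1 by lra.
have q1 : 0 < q + 1 by lra.
(* Both equations give exact relations, th1 = q th2 - alpha and th2 = p th1 - alpha: a linear system
   of determinant pq - 1 up to sign. *)
have slow : q * theta2 < N -> p * theta1 < N ->
    theta1 = alpha * (q + 1) / (p * q - 1) /\ theta2 = alpha * (p + 1) / (p * q - 1).
  move=> /e1 E1 /f1 E2.
  have pqn0 : p * q - 1 != 0 by rewrite gt_eqF.
  have F1 : theta1 * (p * q - 1) = alpha * (q + 1).
    by have : theta1 = q * (p * theta1 - alpha) - alpha; [rewrite -E2|lra].
  have F2 : theta2 * (p * q - 1) = alpha * (p + 1).
    by have : theta2 = p * (q * theta2 - alpha) - alpha; [rewrite -E1|lra].
  by split; [rewrite -F1|rewrite -F2]; rewrite mulfK.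
(* If q th2 >= n then th1 = n - alpha, and p th1 >= th2 + alpha, so the sum exceeds n by at least
   th2; if p th1 >= n, adding th1 > 0 is enough. *)
have fastE : N <= q * theta2 \/ N <= p * theta1 -> N < (p + 1) * theta1.
  by case=> h; [have := e2 h|]; rewrite /N in h *; lra.
have cases : (q * theta2 < N /\ p * theta1 < N) \/
    (N <= q * theta2 \/ N <= p * theta1).
  have [h|h] := leP N (q * theta2); first by right; left.
  by have [h'|h'] := leP N (p * theta1); [right; right|left].
(* Substituting each one-sided relation into the other gives the lower bounds on both rates in every
   case. *)
have qle : q * theta2 <= q * (p * theta1 - alpha) by rewrite ler_pM2l.
have ple : p * theta1 <= p * (q * theta2 - alpha) by rewrite ler_pM2l.
split.
- case: cases => [[s1 s2]|/fastE/crit -> //].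
  (* Above n the energy is finite and criticality gives equality. Otherwise inserting the slow rate
     into (p + 1) theta1 <= n gives alpha (p + 1)(q + 1) <= n (pq - 1), which is the claimed
     inequality after clearing denominators. *)
  have [big|/crit -> //] := leP ((p + 1) * theta1) N.
  have [E1 _] := slow s1 s2.
  have small : (p + 1) * (alpha * (q + 1)) <= N * (p * q - 1).
    by rewrite -ler_pdivrMr// -mulrA -E1.
  rewrite ler_pdivlMr//.
  rewrite [leLHS](_ : _ = ((p + q + 2) * N) / ((p + 1) * (q + 1))); last first.
    by field; rewrite !gt_eqF.
  by rewrite ler_pdivrMr ?mulr_gt0//; lra.
- by rewrite ler_pdivrMr//; lra.
- by rewrite ler_pdivrMr//; lra.
- move=> strict; have fast : N <= q * theta2 \/ N <= p * theta1.
    case: cases => // -[s1 s2]; have [E1 E2] := slow s1 s2.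
    by case: strict; rewrite -?E1 -?E2 ltxx.
  have Nt := fastE fast.
  have [E E0 [EU EV]] := decaying_energy n0 al0 alN p0 q0 t1 t2 sol Nt.
  split.
  + exact: crit.
  + exact: (in_LrP mu u0 EU).
  + exact: (in_LrP mv v0 EV).
  + exact: (fast_decay n0 al0 alN p0 q0 t1 t2 sol au av fast).
  + apply: (fast_decay n0 al0 alN q0 p0 t2 t1 (decaying_solution_sym sol) av au).
    by case: fast; [right|left].
- move=> sub; case: cases => [[s1 s2]|/fastE/crit eq]; first exact: slow.
  by rewrite eq ltxx in sub.
Qed.
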